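(* Let $G$ be a locally compact group and let $\pi:A\to B$ be a $G$-injective embedding of $G$-$C^*$-algebras, i.e. an equivariant injective $*$-homomorphism which is $G$-injective as an equivariant ccp map. Then $A\rtimes_{\mathrm{inj}}G$ identifies with the closure of $C_c(G,A)$ under its natural embedding $\pi\rtimes G$ in $B\rtimes_{\max}G$; that is, $\|a\|_{\mathrm{inj}}=\|(\pi\rtimes G)(a)\|_{B\rtimes_{\max}G}$ for all $a\in C_c(G,A)$.
   Context: A $G$-$C^*$-algebra is a $C^*$-algebra $A$ with a strongly continuous action of $G$ by automorphisms. $C_c(G,A)$ carries its usual convolution $*$-algebra structure; $A\rtimes_{\max}G$ is its maximal $C^*$-completion. For an equivariant $*$-homomorphism $\phi:A\to B$, $\phi\rtimes G$ denotes the map $C_c(G,A)\to C_c(G,B)$, $f\mapsto\phi\circ f$, and its extension to completions. ''ccp'' means contractive completely positive. An equivariant ccp map $\phi:A\to B$ between $G$-$C^*$-algebras is $G$-injective if for every $G$-$C^*$-algebra $C$ and every equivariant injective $*$-homomorphism $\iota:A\to C$ there is an equivariant ccp map $\widetilde\phi:C\to B$ with $\widetilde\phi\circ\iota=\phi$. For an equivariant injective $*$-homomorphism $\iota:A\to B$ of $G$-$C^*$-algebras, put $\|a\|_\iota:=\|(\iota\rtimes G)(a)\|_{B\rtimes_{\max}G}$ for $a\in C_c(G,A)$. The injective norm on $C_c(G,A)$ is $\|a\|_{\mathrm{inj}}:=\inf\{\|a\|_\iota : \iota:A\to B\text{ an equivariant injective }*\text{-homomorphism}\}$, and $A\rtimes_{\mathrm{inj}}G$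 is the corresponding completion of $C_c(G,A)$. *)

(* Defs.v *)
From HB Require Import structures.
From mathcomp Require Import all_boot all_order all_algebra.
From mathcomp Require Import complex.
From mathcomp Require Import all_classical all_reals all_analysis.

Set Implicit Arguments.
Unset Strict Implicit.
Unset Printing Implicit Defensive.

Import Order.TTheory GRing.Theory Num.Theory.
Import numFieldNormedType.Exports.

Local Open Scope classical_set_scope.
Local Open Scope ring_scope.
Local Open Scope complex_scope.

(* Pointed is only there because the measurable types of the library are
   pointed; the point plays no role. *)
HB.mixin Record isLocallyCompactGroup G
    & Pointed G & Topological G & Group G := {
  mulg_continuous : continuous (fun x : G * G => (x.1 * x.2)%g) ;
  invg_continuous : continuous (fun x : G => (x^-1)%g) ;
  lcgroup_hausdorff : hausdorff_space G ;
  lcgroup_locally_compact : locally_compact [set: G]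
}.

#[short(type="lcGroupType")]
HB.structure Definition LocallyCompactGroup :=
  {G of Pointed G & Topological G & Group G & isLocallyCompactGroup G}.

Definition borel (G : lcGroupType) := g_sigma_algebraType (@open G).

Record is_haar (R : realType) (G : lcGroupType)
    (mu : {measure set (borel G) -> \bar R}) : Prop := {
  haar_nonzero : mu [set: G] != 0%E ;
  haar_invariant : forall (s : G) (E : set (borel G)), measurable E ->
    mu [set (s * x : G)%g | x in E] = mu E ;
  haar_compact : forall K : set G, compact K -> (mu K < +oo)%E ;
  haar_outer : forall E : set (borel G), measurable E ->
    mu E = ereal_inf [set mu U | U in [set U : set G | open U /\ E `<=` U]] ;
  haar_inner : forall U : set G, open U ->
    mu U = ereal_sup [set mu K | K in [set K : set G | compact K /\ K `<=` U]]
}.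

(* The norm of a normed R[i]-module takes its values in R[i]; these values are
   real and nonnegative, so that inequalities in R[i] are meaningful. *)
HB.mixin Record CompleteNormedModule_isCStarAlgebra (R : realType) A
    & CompleteNormedModule R[i] A := {
  cmul : A -> A -> A ;
  star : A -> A ;
  cmulA : associative cmul ;
  cmul_linearl : forall b : A, linear (fun a => cmul a b) ;
  cmul_linearr : forall a : A, linear (cmul a) ;
  starK : involutive star ;
  star_antilinear : forall (k : R[i]) (a b : A),
    star (k *: a + b) = k^* *: star a + star b ;
  starM : forall a b : A, star (cmul a b) = cmul (star b) (star a) ;
  norm_cmul_le : forall a b : A, `|cmul a b| <= `|a| * `|b| ;
  cstar_identity : forall a : A, `|cmul (star a) a| = `|a| ^+ 2
}.

#[short(type="cstarType")]
HB.structure Definition CStarAlgebra (R : realType) :=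
  {A of CompleteNormedModule R[i] A & CompleteNormedModule_isCStarAlgebra R A}.

HB.mixin Record CompleteNormedModule_isHilbert (R : realType) H
    & CompleteNormedModule R[i] H := {
  inner : H -> H -> R[i] ;
  inner_linear : forall (k : R[i]) (x y z : H),
    inner (k *: x + y) z = k * inner x z + inner y z ;
  inner_conj : forall x y : H, inner y x = (inner x y)^* ;
  inner_norm : forall x : H, inner x x = `|x| ^+ 2
}.

#[short(type="hilbertType")]
HB.structure Definition Hilbert (R : realType) :=
  {H of CompleteNormedModule R[i] H & CompleteNormedModule_isHilbert R H}.

HB.mixin Record CStarAlgebra_isGCStarAlgebra (R : realType) (G : lcGroupType) A
    & CStarAlgebra R A := {
  gact : G -> A -> A ;
  gact1 : forall a : A, gact 1%g a = a ;
  gactM : forall (s t : G) (a : A), gact (s * t)%g a = gact s (gact t a) ;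
  gact_linear : forall s : G, linear (gact s) ;
  gact_mul : forall (s : G) (a b : A),
    gact s (cmul a b) = cmul (gact s a) (gact s b) ;
  gact_star : forall (s : G) (a : A), gact s (star a) = star (gact s a) ;
  gact_continuous : forall a : A, continuous (fun s : G => gact s a)
}.

#[short(type="gcstarType")]
HB.structure Definition GCStarAlgebra (R : realType) (G : lcGroupType) :=
  {A of CStarAlgebra R A & CStarAlgebra_isGCStarAlgebra R G A}.

Section Maps.
Context {R : realType} {G : lcGroupType}.
Implicit Types A B C : gcstarType R G.

Definition equivariant A B (f : A -> B) : Prop :=
  forall (s : G) (a : A), f (gact s a) = gact s (f a).

Definition star_hom A B (f : A -> B) : Prop :=
  [/\ linear f, (forall a b, f (cmul a b) = cmul (f a) (f b))
    & (forall a, f (star a) = star (f a))].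

Definition equivariant_embedding A B (f : A -> B) : Prop :=
  [/\ star_hom f, injective f & equivariant f].

(* Positivity in the C*-algebra M_n(A): M = X^* X for some X in M_n(A). *)
Definition mx_positive A n (M : 'M[A]_n) : Prop :=
  exists X : 'M[A]_n,
    forall i j, M i j = \sum_(k < n) cmul (star (X k i)) (X k j).

Definition completely_positive A B (f : A -> B) : Prop :=
  linear f /\
  forall n (M : 'M[A]_n), mx_positive M -> mx_positive (map_mx f M).

Definition contractive A B (f : A -> B) : Prop := forall a, `|f a| <= `|a|.

Definition equivariant_ccp A B (f : A -> B) : Prop :=
  [/\ completely_positive f, contractive f & equivariant f].

Definition G_injective A B (f : A -> B) : Prop :=
  equivariant_ccp f /\
  forall (C : gcstarType R G) (iota : A -> C), equivariant_embedding iota ->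
    exists2 g : C -> B, equivariant_ccp g & g \o iota = f.

End Maps.

Section CrossedProducts.
Context {R : realType} {G : lcGroupType}.
Implicit Types (A B : gcstarType R G) (H : hilbertType R).
Implicit Types mu : {measure set (borel G) -> \bar R}.

Definition Cc A : set (G -> A) :=
  [set f | continuous f /\ compact (closure [set s | f s != 0])].

Definition crossed_map A B (phi : A -> B) (f : G -> A) : G -> B := phi \o f.

Definition bounded_operator H (T : H -> H) : Prop := linear T /\ continuous T.

Definition opnorm H (T : H -> H) : \bar R :=
  ereal_sup [set (complex.Re `|T x|)%:E | x in [set x : H | `|x| <= 1]].

(* (rho, u) is a (possibly degenerate) covariant representation of (A, G) on H:
   a *-representation rho and a strongly continuous unitary representation u,
   with u_s rho(a) = rho(s.a) u_s. *)
Record covariant_rep A H (rho : A -> H -> H) (u : G -> H -> H) : Prop := {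
  rho_bounded : forall a, bounded_operator (rho a) ;
  rho_linear : forall x, linear (fun a => rho a x) ;
  rho_mul : forall a b x, rho (cmul a b) x = rho a (rho b x) ;
  rho_star : forall a x y, inner (rho (star a) x) y = inner x (rho a y) ;
  u_one : forall x, u 1%g x = x ;
  u_mul : forall s t x, u (s * t)%g x = u s (u t x) ;
  u_linear : forall s, linear (u s) ;
  u_unitary : forall s x y, inner (u s x) (u s y) = inner x y ;
  u_continuous : forall x, continuous (fun s => u s x) ;
  rho_covariant : forall s a x, u s (rho a x) = rho (gact s a) (u s x)
}.

Definition cintegral mu (f : G -> R[i]) : R[i] :=
  (\int[mu]_s complex.Re (f s)) +i* (\int[mu]_s complex.Im (f s)).

(* T is the integrated form of f under (rho, u), i.e. the operator-valued
   integral of rho(f(s)) u_s, understood weakly. *)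
Definition integrated_form mu A H (rho : A -> H -> H) (u : G -> H -> H)
    (f : G -> A) (T : H -> H) : Prop :=
  bounded_operator T /\
  forall x y, inner (T x) y = cintegral mu (fun s => inner (rho (f s) (u s x)) y).

(* The norm of f in the maximal crossed product: the supremum of the norms of
   the integrated forms of f under all covariant representations. *)
Definition max_norm mu A (f : G -> A) : \bar R :=
  ereal_sup [set r | exists (H : hilbertType R) (rho : A -> H -> H)
      (u : G -> H -> H) (T : H -> H),
    [/\ covariant_rep rho u, integrated_form mu rho u f T & r = opnorm T]].

Definition inj_norm mu A (f : G -> A) : \bar R :=
  ereal_inf [set r | exists (B : gcstarType R G) (iota : A -> B),
    equivariant_embedding iota /\ r = max_norm mu (crossed_map iota f)].

End CrossedProducts.

Arguments Cc {R G} A _.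

(* Main.v *)
Require Import Defs.
From HB Require Import structures.
From mathcomp Require Import all_boot all_order all_algebra.
From mathcomp Require Import complex.
From mathcomp Require Import all_classical all_reals all_analysis.
From mathcomp Require Import ring lra.

Set Implicit Arguments.
Unset Strict Implicit.
Unset Printing Implicit Defensive.

Import Order.TTheory GRing.Theory Num.Theory.
Import numFieldNormedType.Exports.

Local Open Scope classical_set_scope.
Local Open Scope ring_scope.
Local Open Scope complex_scope.

(** One inequality is immediate, since [pi] is one of the embeddings in the
    infimum. For the other, let [iota : A -> C] be any equivariant embedding.
    As [pi] is G-injective, [pi = g \o iota] for an equivariant ccp map
    [g : C -> B], so it suffices that equivariant ccp maps do not increase
    the maximal norm ([max_norm_ccp]).

    This is a covariant Stinespring theorem. For a covariant representation
    (rho, u) of B on H, the map psi = rho o g is ccp and covariant for u. On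
    finite sums of elementary tensors of C and H take the semi-inner product
    << c (x) x | d (x) y >> = < psi (d^* c) x | y >. There C acts by left
    multiplication (rho'), G acts diagonally (u'), and c (x) x |-> psi c x is
    a contraction to H, with adjoint V. One finds psi c = V^* rho' c V and
    u'_s V = V u_s ([dilation_compression]). Hence the integrated form of
    g o f under (rho, u) is V^* T V, where T is the integrated form of f under
    (rho', u'), and its norm is at most that of T ([opnorm_dilation]).

    The Hilbert space of the dilation is the space of all bounded antilinear
    functionals on the semi-inner product space. It is complete, it needs no
    passage to a quotient, operators act on it by pullback along their
    adjoints, and V x is the functional z |-> < x | W z >, where W is the
    contraction above. Its inner product comes from the density of the
    functionals < z | - > ([riesz_approx]), which is proved by minimizing
    |z|^2 - 2 Re (F z); the same argument gives the Riesz theorem.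

    That W is a contraction is the Schwarz inequality for psi ([compress_le]).
    As C may have no unit, it uses approximate units, and these come from
    resolvents: if p is selfadjoint and y = p (p + is)^-1, then
    2 y^* y = y + y^*, so that |y| <= 1 and |p - p y| = s |y| <= s.

    Positivity in C^*-algebras enters only through the elements h with
    1 - p = (1 - h)^2 for selfadjoint p with |p| < 1, which are fixed points of
    h |-> (p + h^2) / 2 ([sqrt_one_sub]). They show that *-representations and
    *-homomorphisms are contractive. The former makes the integrands of
    integrated forms continuous, so that integrated forms exist by the Riesz
    theorem ([integrated_form_exists]); the latter makes iota o a continuous. *)

(** * Real-valued norms *)

Section RealNorm.
Context {R : realType}.

(** Norms over [R[i]] are valued in [R[i]]; their real values live in an ordered
    field, where linear and polynomial arithmetic is available. *)
Definition rnorm (V : normedZmodType R[i]) (x : V) : R := complex.Re `|x|.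

Lemma rnormE (V : normedZmodType R[i]) (x : V) : `|x| = (rnorm x)%:C.
Proof. by rewrite /rnorm RRe_real// ger0_real. Qed.

Lemma rnorm_le (V W : normedZmodType R[i]) (x : V) (y : W) :
  (`|x| <= `|y|) = (rnorm x <= rnorm y).
Proof. by rewrite !rnormE lecR. Qed.

Lemma rnorm_ge0 (V : normedZmodType R[i]) (x : V) : 0 <= rnorm x.
Proof. by rewrite -ler0c -rnormE. Qed.

Lemma rnorm0 (V : normedZmodType R[i]) : rnorm (0 : V) = 0.
Proof. by rewrite /rnorm normr0. Qed.

Lemma rnorm0_eq0 (V : normedZmodType R[i]) (x : V) : rnorm x = 0 -> x = 0.
Proof. by move=> x0; apply/normr0_eq0; rewrite rnormE x0. Qed.

Lemma rnormD (V : normedZmodType R[i]) (x y : V) :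
  rnorm (x + y) <= rnorm x + rnorm y.
Proof. by rewrite -lecR rmorphD/= -!rnormE ler_normD. Qed.

Lemma rnormN (V : normedZmodType R[i]) (x : V) : rnorm (- x) = rnorm x.
Proof. by rewrite /rnorm normrN. Qed.

Lemma rnormB (V : normedZmodType R[i]) (x y : V) :
  rnorm (x - y) <= rnorm x + rnorm y.
Proof. by rewrite -(rnormN y) rnormD. Qed.

Lemma rdistC (V : normedZmodType R[i]) (x y : V) : rnorm (x - y) = rnorm (y - x).
Proof. by rewrite /rnorm distrC. Qed.

Lemma rdistD (V : normedZmodType R[i]) (y x z : V) :
  rnorm (x - z) <= rnorm (x - y) + rnorm (y - z).
Proof. by rewrite -[x - z](subrKA y) rnormD. Qed.

Lemma rnorm_sum (V : normedZmodType R[i]) (I : Type) (r : seq I) (F : I -> V) :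
  rnorm (\sum_(i <- r) F i) <= \sum_(i <- r) rnorm (F i).
Proof.
elim: r => [|i r IH]; first by rewrite !big_nil rnorm0.
by rewrite !big_cons (le_trans (rnormD _ _))// lerD2l.
Qed.

Lemma rnormZ (V : normedModType R[i]) (k : R[i]) (x : V) :
  rnorm (k *: x) = rnorm k * rnorm x.
Proof. by apply: complexI; rewrite rmorphM/= -!rnormE normrZ. Qed.

Lemma rnormM (x y : R[i]) : rnorm (x * y) = rnorm x * rnorm y.
Proof. by apply: complexI; rewrite rmorphM/= -!rnormE normrM. Qed.

Lemma rnormJ (x : R[i]) : rnorm x^*%C = rnorm x.
Proof. by rewrite /rnorm normcJ. Qed.

Lemma rnormR (x : R) : rnorm x%:C = `|x|.
Proof. by rewrite /rnorm normc_def/= expr0n/= addr0 sqrtr_sqr. Qed.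

Lemma rnorm1 : rnorm (1 : R[i]) = 1.
Proof. by rewrite /rnorm normr1. Qed.

Lemma rnorm_i : rnorm ('i : R[i]) = 1.
Proof. by rewrite /rnorm normc_def/= expr0n/= add0r expr1n sqrtr1. Qed.

Lemma conjcR (x : R) : (x%:C)^*%C = x%:C.
Proof. exact: conjc_real. Qed.

Lemma conjcD (x y : R[i]) : (x + y)^*%C = x^*%C + y^*%C.
Proof. exact: rmorphD. Qed.

Lemma conjcN (x : R[i]) : (- x)^*%C = - x^*%C.
Proof. exact: rmorphN. Qed.

Lemma conjcM (x y : R[i]) : (x * y)^*%C = x^*%C * y^*%C.
Proof. exact: rmorphM. Qed.

Lemma rcM (x y : R) : (x * y)%:C = x%:C * y%:C.
Proof. exact: rmorphM. Qed.

Lemma rcX (x : R) n : (x ^+ n)%:C = x%:C ^+ n.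
Proof. exact: rmorphXn. Qed.

Lemma rnorm_sqr (x : R[i]) : (rnorm x ^+ 2)%:C = x * x^*%C.
Proof. by rewrite rmorphXn/= -rnormE sqr_normc. Qed.

Lemma normr_Re_le (x : R[i]) : `|complex.Re x| <= rnorm x.
Proof. by rewrite -lecR -rnormE normc_ge_Re. Qed.

Lemma Re_le_rnorm (x : R[i]) : complex.Re x <= rnorm x.
Proof. exact: le_trans (ler_norm _) (normr_Re_le x). Qed.

Lemma normr_Im_le (x : R[i]) : `|complex.Im x| <= rnorm x.
Proof.
by rewrite /rnorm normc_def/= -sqrtr_sqr ler_wsqrtr// lerDr sqr_ge0.
Qed.

Lemma rnorm_le_ReIm (x : R[i]) : rnorm x <= `|complex.Re x| + `|complex.Im x|.
Proof.
rewrite [in X in X <= _](complexE x) (le_trans (rnormD _ _))// rnormM rnorm_i.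
by rewrite mul1r !rnormR.
Qed.

Lemma rnorm_le0_eq0 (V : normedZmodType R[i]) (x : V) :
  (forall e : R, 0 < e -> rnorm x <= e) -> x = 0.
Proof.
move=> xe; apply: rnorm0_eq0; apply/eqP; rewrite eq_le rnorm_ge0 andbT.
by apply/ler_addgt0Pl => e e0; rewrite addr0 xe.
Qed.

Lemma rnorm_le0_scale (V : normedZmodType R[i]) (x : V) (C : R) :
  (forall e : R, 0 < e -> e <= 1 -> rnorm x <= C * e) -> x = 0.
Proof.
move=> xC; apply: rnorm_le0_eq0 => e e0.
have C1 : 0 < `|C| + 1 by rewrite ltr_wpDl.
pose d := Num.min 1 (e / (`|C| + 1)).
have d0 : 0 < d by rewrite /d lt_min ltr01 divr_gt0.
have d1 : d <= 1 by rewrite /d ge_min lexx.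
have de : d <= e / (`|C| + 1) by rewrite /d ge_min lexx orbT.
rewrite (le_trans (xC d d0 d1))// (@le_trans _ _ ((`|C| + 1) * d))//.
  by rewrite ler_wpM2r ?(ltW d0)// ler_wpDr// ler_norm.
by rewrite mulrC -ler_pdivlMr.
Qed.

Lemma rnorm_gt0c (e : R[i]) : 0 < e -> exists2 r : R, 0 < r & e = r%:C.
Proof.
move=> e0; exists (complex.Re e); last by rewrite RRe_real// gtr0_real.
by move: e0; rewrite ltcE => /andP[].
Qed.

End RealNorm.

Section LinearPredicate.
Context {K : pzRingType} {U V : lmodType K} (f : U -> V).
Context (fl : linear f).

Lemma linear_fun0 : f 0 = 0.
Proof. by have := fl (-1) 0 0; rewrite scaler0 addr0 scaleN1r addNr. Qed.

Lemma linear_funD x y : f (x + y) = f x + f y.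
Proof. by rewrite -[x]scale1r fl !scale1r. Qed.

Lemma linear_funZ k x : f (k *: x) = k *: f x.
Proof. by rewrite -[k *: x]addr0 fl linear_fun0 addr0. Qed.

Lemma linear_funN x : f (- x) = - f x.
Proof. by rewrite -scaleN1r linear_funZ scaleN1r. Qed.

Lemma linear_funB x y : f (x - y) = f x - f y.
Proof. by rewrite linear_funD linear_funN. Qed.

Lemma linear_fun_sum (I : Type) (r : seq I) (F : I -> U) :
  f (\sum_(i <- r) F i) = \sum_(i <- r) f (F i).
Proof.
by elim/big_ind2 : _ => [|x y w t <- <-|//]; rewrite ?linear_fun0 ?linear_funD.
Qed.

End LinearPredicate.

Section Convergence.
Context {R : realType}.

Definition rcauchy (V : normedZmodType R[i]) (u : nat -> V) : Prop :=
  forall e : R, 0 < e -> exists N, forall n m, (N <= n)%N -> (N <= m)%N ->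
    rnorm (u n - u m) <= e.

Definition rcvg (V : normedZmodType R[i]) (u : nat -> V) (l : V) : Prop :=
  forall e : R, 0 < e -> exists N, forall n, (N <= n)%N -> rnorm (u n - l) <= e.

Lemma rcauchy_rcvg (V : completeNormedModType R[i]) (u : nat -> V) :
  rcauchy u -> exists l, rcvg u l.
Proof.
move=> cu.
have : cauchy (u @ \oo).
  apply/cauchyP => e e0; have [r r0 er] := rnorm_gt0c e0.
  have [|N Nu] := cu (r / 2); first by rewrite divr_gt0.
  exists (u N); exists N => //= n /= Nn; rewrite -ball_normE/= er rnormE ltcR.
  by apply: le_lt_trans (Nu _ _ _ _) _ => //; rewrite ltr_pdivrMr// ltr_pMr// ltr1n.
move=> /cauchy_cvg /cvg_ex[l ul]; exists l => e e0.
have e0c : 0 < e%:C :> R[i] by rewrite ltcR.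
have /cvgrPdist_lt/(_ _ e0c)[N _ Nu] := ul.
by exists N => n Nn; have := Nu n Nn; rewrite rnormE ltcR rdistC => /ltW.
Qed.

Lemma continuousP (T : topologicalType) (V : normedModType R[i]) (f : T -> V) :
  continuous f <->
  forall t (e : R), 0 < e -> \forall s \near t, rnorm (f s - f t) <= e.
Proof.
split=> [cf t e e0|cf t].
  have e0c : 0 < e%:C :> R[i] by rewrite ltcR.
  have /cvgrPdist_le/(_ _ e0c) := cf t.
  by apply: filterS => s; rewrite rnormE lecR rdistC.
apply/cvgrPdist_le => e e0; have [r r0 ->] := rnorm_gt0c e0.
by apply: filterS (cf t r r0) => s; rewrite rnormE lecR rdistC.
Qed.

End Convergence.

(** * Elements of C*-algebras *)

Section FixedPoint.
Context {R : realType} {V : completeNormedModType R[i]}.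

Lemma exprn_small (t e : R) : 0 <= t -> t < 1 -> 0 < e -> exists n, t ^+ n <= e.
Proof.
move=> t0 t1 e0; have : (fun n => t ^+ n) @ \oo --> (0 : R).
  by apply: cvg_expr; rewrite ger0_norm.
move=> /cvgrPdist_le/(_ _ e0)[N _ /(_ N (leqnn N))].
by rewrite sub0r normrN ger0_norm ?exprn_ge0//; exists N.
Qed.

Lemma contraction_fixpoint (D : V -> Prop) (f : V -> V) (t : R) (x0 : V) :
  0 <= t < 1 -> D x0 -> (forall x, D x -> D (f x)) ->
  (forall x y, D x -> D y -> rnorm (f x - f y) <= t * rnorm (x - y)) ->
  (forall x, (forall e : R, 0 < e -> exists2 y, D y & rnorm (x - y) <= e) -> D x) ->
  exists2 x, D x & f x = x.
Proof.
move=> /andP[t0 t1] D0 Df fc Dcl; pose u n := iter n f x0.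
have Du n : D (u n) by elim: n => //= n; exact: Df.
have t1' : 0 < 1 - t by rewrite subr_gt0.
pose d := rnorm (u 1%N - u 0%N) / (1 - t).
have d0 : 0 <= d by rewrite divr_ge0 ?rnorm_ge0// ltW.
have ud n : rnorm (u n.+1 - u n) <= t ^+ n * rnorm (u 1%N - u 0%N).
  elim: n => [|n IH]; first by rewrite mul1r.
  rewrite exprS -mulrA (le_trans (fc _ _ (Du n.+1) (Du n)))//; exact: ler_wpM2l.
have ug n k : rnorm (u (n + k)%N - u n) <= t ^+ n * (1 - t ^+ k) * d.
  elim: k => [|k IH]; first by rewrite addn0 subrr rnorm0 subrr mulr0 mul0r.
  rewrite addnS; apply: le_trans (rdistD (u (n + k)%N) _ _) _.
  apply: le_trans (lerD (ud _) IH) _.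
  have -> : rnorm (u 1%N - u 0%N) = (1 - t) * d.
    by rewrite /d mulrCA mulfV ?mulr1// gt_eqF.
  rewrite [t ^+ (n + k)]exprD [t ^+ k.+1]exprS le_eqVlt; apply/orP; left.
  by apply/eqP; ring.
have ug' n m : (n <= m)%N -> rnorm (u m - u n) <= t ^+ n * d.
  move=> nm; rewrite -(subnKC nm) (le_trans (ug _ _))// ler_wpM2r//.
  by rewrite ler_piMr ?exprn_ge0// gerBl exprn_ge0.
have small e : 0 < e -> exists N, forall n, (N <= n)%N -> t ^+ n * d <= e.
  move=> e0; have d1 : 0 < d + 1 by rewrite ltr_wpDl.
  have [|N tN] := @exprn_small t (e / (d + 1)) t0 t1; first by rewrite divr_gt0.
  exists N => n Nn; rewrite (@le_trans _ _ (e / (d + 1) * d))//.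
    rewrite ler_wpM2r// (le_trans _ tN)// -(subnKC Nn) exprD ler_piMr ?exprn_ge0//.
    by rewrite exprn_ile1// ltW.
  by rewrite mulrAC ler_pdivrMr// ler_wpM2l ?ltW// ltrDl.
have /rcauchy_rcvg[l ul] : rcauchy u.
  move=> e e0; have [|N Ne] := small (e / 2); first by rewrite divr_gt0.
  exists N => n m Nn Nm; apply: le_trans (rdistD (u N) _ _) _.
  rewrite (rdistC (u N)) [leRHS]splitr.
  by rewrite lerD// (le_trans (ug' _ _ _))// Ne.
have Dl : D l.
  apply: Dcl => e /ul[N Nu]; exists (u N) => //.
  by rewrite rdistC Nu.
exists l => //; apply/eqP; rewrite -subr_eq0; apply/eqP/rnorm_le0_eq0 => e e0.
have [|N Nu] := ul (e / 2); first by rewrite divr_gt0.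
apply: le_trans (rdistD (u N.+1) _ _) _; rewrite [leRHS]splitr lerD ?Nu//.
rewrite (le_trans (fc _ _ _ _))// -[leRHS]mul1r ler_pM ?rnorm_ge0// ?(ltW t1)//.
by rewrite rdistC Nu.
Qed.

End FixedPoint.

Section CStar.
Context {R : realType} {A : cstarType R}.
Implicit Types (a b c e h p x y : A) (k : R[i]).

Local Notation "a ** b" := (cmul a b) (at level 40, left associativity).

Lemma cmulDl a b c : (a + b) ** c = a ** c + b ** c.
Proof. by have := cmul_linearl c 1 a b; rewrite !scale1r. Qed.
Lemma cmulDr a b c : c ** (a + b) = c ** a + c ** b.
Proof. by have := cmul_linearr c 1 a b; rewrite !scale1r. Qed.
Lemma cmul0l c : 0 ** c = 0.
Proof. by apply: (@addrI _ (0 ** c)); rewrite -cmulDl !addr0. Qed.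
Lemma cmul0r c : c ** 0 = 0.
Proof. by apply: (@addrI _ (c ** 0)); rewrite -cmulDr !addr0. Qed.
Lemma cmulZl k a c : (k *: a) ** c = k *: (a ** c).
Proof. by have := cmul_linearl c k a 0; rewrite cmul0l !addr0. Qed.
Lemma cmulZr k a c : c ** (k *: a) = k *: (c ** a).
Proof. by have := cmul_linearr c k a 0; rewrite cmul0r !addr0. Qed.
Lemma cmulNl a c : (- a) ** c = - (a ** c).
Proof. by rewrite -scaleN1r cmulZl scaleN1r. Qed.
Lemma cmulNr a c : c ** (- a) = - (c ** a).
Proof. by rewrite -scaleN1r cmulZr scaleN1r. Qed.
Lemma cmulBl a b c : (a - b) ** c = a ** c - b ** c.
Proof. by rewrite cmulDl cmulNl. Qed.
Lemma cmulBr a b c : c ** (a - b) = c ** a - c ** b.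
Proof. by rewrite cmulDr cmulNr. Qed.
Lemma cmul_sumr (I : Type) (r : seq I) (F : I -> A) c :
  c ** (\sum_(i <- r) F i) = \sum_(i <- r) c ** F i.
Proof. by elim/big_ind2 : _ => [|x y z t <- <-|//]; rewrite ?cmul0r ?cmulDr. Qed.
Lemma cmul_suml (I : Type) (r : seq I) (F : I -> A) c :
  (\sum_(i <- r) F i) ** c = \sum_(i <- r) F i ** c.
Proof. by elim/big_ind2 : _ => [|x y z t <- <-|//]; rewrite ?cmul0l ?cmulDl. Qed.

Lemma starD a b : star (a + b) = star a + star b.
Proof. by have := star_antilinear 1 a b; rewrite rmorph1 !scale1r. Qed.
Lemma star0 : star (0 : A) = 0.
Proof. by apply: (@addrI _ (star (0 : A))); rewrite -starD !addr0. Qed.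
Lemma starZ k a : star (k *: a) = k^*%C *: star a.
Proof. by have := star_antilinear k a 0; rewrite star0 !addr0. Qed.
Lemma starN a : star (- a) = - star a.
Proof. by rewrite -scaleN1r starZ rmorphN rmorph1 scaleN1r. Qed.
Lemma starB a b : star (a - b) = star a - star b.
Proof. by rewrite starD starN. Qed.

Lemma rnorm_cmul a b : rnorm (a ** b) <= rnorm a * rnorm b.
Proof. by rewrite -lecR rmorphM/= -!rnormE norm_cmul_le. Qed.

Lemma rnorm_star_cmul a : rnorm (star a ** a) = rnorm a ^+ 2.
Proof. by apply: complexI; rewrite rmorphXn/= -!rnormE cstar_identity. Qed.

Lemma rnorm_star a : rnorm (star a) = rnorm a.
Proof.
have le c : rnorm c <= rnorm (star c).
  have [c0|c0] := eqVneq (rnorm c) 0; first by rewrite c0 rnorm_ge0.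
  have cpos : 0 < rnorm c by rewrite lt0r c0 rnorm_ge0.
  by rewrite -(ler_pM2r cpos) -expr2 -rnorm_star_cmul rnorm_cmul.
by apply/le_anti; rewrite le andbT -[X in _ <= rnorm X]starK le.
Qed.

Lemma selfadjoint_closed a :
  (forall e : R, 0 < e -> exists2 b, star b = b & rnorm (a - b) <= e) -> star a = a.
Proof.
move=> ab; apply/eqP; rewrite -subr_eq0; apply/eqP/rnorm_le0_eq0 => e e0.
have [|b sb bd] := ab (e / 2); first by rewrite divr_gt0.
apply: le_trans (rdistD b _ _) _; rewrite [leRHS]splitr lerD//; last by rewrite rdistC.
by rewrite -{1}sb -starB rnorm_star.
Qed.

Lemma halfC : 2^-1 = (2^-1)%:C :> R[i].
Proof. by rewrite fmorphV/= rmorph_nat. Qed.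

(** In the unitization this says that 1 - p = (1 - h)^2. The map
    h |-> (p + h^2) / 2 is a contraction of the ball of radius |p|, and it
    preserves the closed set of selfadjoint elements commuting with q. *)
Lemma sqrt_one_sub p q : star p = p -> rnorm p < 1 -> q ** p = p ** q ->
  exists h, [/\ star h = h, p = h + h - h ** h & q ** h = h ** q].
Proof.
move=> sp p1 qp; set r := rnorm p in p1.
pose D (h : A) := [/\ star h = h, q ** h = h ** q & rnorm h <= r].
have [|||||h [sh qh _] hp] := @contraction_fixpoint R A D
    (fun h => 2^-1 *: (p + h ** h)) r 0.
- by rewrite rnorm_ge0.
- by split; rewrite ?star0 ?cmul0l ?cmul0r ?rnorm0 ?rnorm_ge0.
- move=> h [sh qh hr]; split.
  + rewrite starZ starD starM sh sp; congr (_ *: _).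
    by rewrite halfC conjc_real.
  + by rewrite cmulZr cmulZl cmulDr cmulDl qp cmulA qh -cmulA qh cmulA.
  rewrite halfC rnormZ rnormR ger0_norm// mulrC ler_pdivrMr// mulr_natr mulr2n.
  rewrite (le_trans (rnormD _ _))// lerD// (le_trans (rnorm_cmul _ _))//.
  by rewrite -[leRHS]mulr1 ler_pM ?rnorm_ge0// (le_trans hr)// ltW.
- move=> h k [_ _ hr] [_ _ kr].
  have -> : 2^-1 *: (p + h ** h) - 2^-1 *: (p + k ** k) =
            2^-1 *: (h ** (h - k) + (h - k) ** k).
    rewrite -scalerBr; congr (_ *: _); rewrite cmulBr cmulBl.
    by rewrite opprD addrACA subrr add0r addrA subrK.
  rewrite halfC rnormZ rnormR ger0_norm// mulrC ler_pdivrMr// mulr_natr mulr2n.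
  rewrite (le_trans (rnormD _ _))// lerD// (le_trans (rnorm_cmul _ _))//.
    by rewrite ler_wpM2r ?rnorm_ge0.
  by rewrite mulrC ler_wpM2r ?rnorm_ge0.
- move=> h hD; split.
  + by apply: selfadjoint_closed => e /hD[b [sb _ _] bd]; exists b.
  + apply/eqP; rewrite -subr_eq0; apply/eqP.
    apply: (@rnorm_le0_scale _ _ _ (rnorm q + rnorm q)) => e /hD[b [_ qb _] bd] _.
    have -> : q ** h - h ** q = q ** (h - b) - (h - b) ** q.
      by rewrite cmulBr cmulBl qb opprB addrA subrK.
    rewrite (le_trans (rnormB _ _))// mulrDl lerD// (le_trans (rnorm_cmul _ _))//.
      by rewrite ler_wpM2l ?rnorm_ge0.
    by rewrite mulrC ler_wpM2l ?rnorm_ge0.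
  apply/ler_addgt0Pl => e /hD[b [_ _ br] bd].
  by rewrite -(subrK b h) (le_trans (rnormD _ _))// lerD.
exists h; split=> //; apply/eqP; rewrite eq_sym subr_eq -{1 2}hp -scalerDl.
have -> : 2^-1 + 2^-1 = 1 :> R[i] by rewrite [RHS]splitr div1r.
by rewrite scale1r.
Qed.

(** With t = p + i m and t' = p - i m, both t^* t and t'^* t' are p^2 + m^2,
    and p is the half-sum of t and t'. *)
Lemma rnorm_le_sum_squares p m : star p = p -> star m = m -> p ** m = m ** p ->
  rnorm p ^+ 2 <= rnorm (p ** p + m ** m).
Proof.
move=> sp sm pm; set s := p ** p + m ** m.
have iJ : ('i : R[i])^*%C = - 'i by apply/eqP; rewrite eq_complex/= oppr0 !eqxx.
have ii : 'i * 'i = -1 :> R[i] by rewrite -expr2 sqr_i.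
have sq (k : R[i]) : k^*%C = - k -> k * k = -1 -> rnorm (p + k *: m) ^+ 2 = rnorm s.
  move=> kJ kk; rewrite -rnorm_star_cmul starD starZ sp sm kJ.
  rewrite cmulDl !cmulDr !cmulZl !cmulZr pm scalerA mulNr kk opprK scale1r.
  by rewrite addrA scaleNr -(addrA (p ** p)) subrr addr0.
have sq1 := sq 'i iJ ii.
have sq2 : rnorm (p + (- 'i) *: m) ^+ 2 = rnorm s.
  by apply: sq; rewrite ?mulrNN// conjcN iJ.
have eq1 : rnorm (p + 'i *: m) = rnorm (p + (- 'i) *: m).
  by apply/eqP; rewrite -(@eqrXn2 _ 2)// ?rnorm_ge0// sq1 sq2.
rewrite -sq1 ler_pXn2r// ?nnegrE ?rnorm_ge0//.
rewrite -(@ler_pM2l _ 2)//.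
have -> : 2 * rnorm p = rnorm ((p + 'i *: m) + (p + (- 'i) *: m)).
  rewrite addrACA scaleNr subrr addr0 -[in RHS](scale1r p) -scalerDl rnormZ.
  rewrite -[1 + 1]/(2%:R) -(rmorph_nat (real_complex R)) rnormR.
  by rewrite ger0_norm.
rewrite mulr_natl mulr2n {2}eq1; exact: rnormD.
Qed.

(** The relation says that 2 y - 1 = (p - z) (p + z)^-1, the Cayley transform of
    p when z = i s, is an isometry. It results from the two evaluations of
    y^* p y by means of p y = p - z y and of its adjoint. *)
Lemma cayley_identity p y (z : R[i]) : star p = p -> z != 0 -> z^*%C = - z ->
  p ** y + z *: y = p -> star y ** y + star y ** y = y + star y.
Proof.
move=> sp z0 zJ py.
have pyE : p ** y = p - z *: y by apply/eqP; rewrite eq_sym subr_eq py.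
have ypE : star y ** p = p + z *: star y.
  by rewrite -{1}sp -starM pyE starB sp starZ zJ scaleNr opprK.
have E : p - z *: y + z *: (star y ** y) = p + z *: star y - z *: (star y ** y).
  have : star y ** p ** y = star y ** (p ** y) by rewrite cmulA.
  by rewrite {1}ypE cmulDl cmulZl pyE cmulBr ypE cmulZr.
apply: (scalerI z0); rewrite !scalerDr; apply: (addrI (p - z *: y)).
by rewrite addrA E subrK addrA subrK.
Qed.

Lemma cayley_le1 y : star y ** y + star y ** y = y + star y -> rnorm y <= 1.
Proof.
move=> yy; have [y0|y0] := eqVneq (rnorm y) 0; first by rewrite y0.
have ypos : 0 < rnorm y by rewrite lt0r y0 rnorm_ge0.
rewrite -(ler_pM2l ypos) mulr1 -expr2 -rnorm_star_cmul.
rewrite -(@ler_pM2l _ 2)// -{1}[2]normr_nat -{1}rnormR -rnormZ rmorph_nat.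
rewrite scaler_nat mulr2n yy (le_trans (rnormD _ _))// rnorm_star.
by rewrite mulr_natl mulr2n.
Qed.

(** In the unitization, y = p (p + i s)^-1. *)
Definition resolvent p (s : R) y := p ** y + (s *i) *: y = p.

Lemma im_neq0 (s : R) : 0 < s -> s *i != 0 :> R[i].
Proof. by move=> s0; rewrite eq_complex/= eqxx gt_eqF. Qed.

Lemma resolvent_cayley p s y : star p = p -> 0 < s -> resolvent p s y ->
  star y ** y + star y ** y = y + star y.
Proof.
move=> sp s0; apply: cayley_identity => //; first exact: im_neq0.
by apply/eqP; rewrite eq_complex/= oppr0 !eqxx.
Qed.

Lemma rnorm_im (s : R) : 0 < s -> rnorm (s *i : R[i]) = s.
Proof.
by move=> s0; rewrite /rnorm normc_def/= expr0n/= add0r sqrtr_sqr gtr0_norm.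
Qed.

Lemma affine_fixpoint (L : A -> A) b (t : R) : 0 <= t < 1 ->
  (forall x y, L (x - y) = L x - L y) -> (forall x, rnorm (L x) <= t * rnorm x) ->
  exists y, y = b + L y.
Proof.
move=> t01 LB Lt.
have [|||||y _ yb] := @contraction_fixpoint R A (fun=> True) (fun y => b + L y) t 0.
- by [].
- by [].
- by [].
- by move=> x y _ _; rewrite opprD addrACA subrr add0r -LB.
- by [].
by exists y.
Qed.

Lemma resolvent_large p (s : R) : rnorm p < s -> exists y, resolvent p s y.
Proof.
move=> ps; have s0 : 0 < s by rewrite (le_lt_trans (rnorm_ge0 p)).
have z0 := im_neq0 s0.
have [|||y yE] := @affine_fixpoint (fun y => - ((s *i)^-1 *: (p ** y)))
    ((s *i)^-1 *: p) (rnorm p / s).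
- by rewrite divr_ge0 ?rnorm_ge0 ?ltW//= ltr_pdivrMr// mul1r.
- by move=> x y; rewrite cmulBr scalerBr opprD.
- move=> x; rewrite rnormN rnormZ.
  have -> : rnorm (s *i)^-1 = s^-1.
    apply: (mulfI (lt0r_neq0 s0)).
    by rewrite -{1}(rnorm_im s0) -rnormM (mulfV z0) rnorm1 mulfV// gt_eqF.
  by rewrite [rnorm p / s]mulrC -mulrA ler_wpM2l ?rnorm_cmul// invr_ge0 ltW.
exists y; rewrite /resolvent {2}yE scalerBr !scalerA mulfV// !scale1r.
by rewrite addrC subrK.
Qed.

(** The resolvent equation at s' = (1 - q) s is equivalent to
    y' = y + q (y' - y y'). As |y| <= 1, the right-hand side is a contraction
    for q = 1/4, whatever s is; this is what lets s be decreased to 0. *)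
Lemma resolvent_shrink p (s : R) y : star p = p -> 0 < s -> resolvent p s y ->
  exists y', resolvent p (3/4 * s) y'.
Proof.
move=> sp s0 py; have y1 := cayley_le1 (resolvent_cayley sp s0 py).
have [|||y' yE] := @affine_fixpoint (fun x => (4^-1)%:C *: (x - y ** x)) y (1/2).
- by lra.
- move=> u v; rewrite -scalerBr; congr (_ *: _).
  by rewrite cmulBr !opprD !opprK addrACA.
- move=> x; rewrite rnormZ rnormR ger0_norm//.
  have -> : 1 / 2 * rnorm x = 4^-1 * (rnorm x + rnorm x) by field.
  rewrite ler_wpM2l// (le_trans (rnormB _ _))// lerD2l.
  by rewrite (le_trans (rnorm_cmul _ _))// ler_piMl ?rnorm_ge0.
exists y'; rewrite /resolvent.
pose T x := p ** x + (s *i) *: x.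
have TB u v : T (u - v) = T u - T v by rewrite /T cmulBr scalerBr opprD addrACA.
have TD u v : T (u + v) = T u + T v by rewrite /T cmulDr scalerDr addrACA.
have TZ k u : T (k *: u) = k *: T u.
  by rewrite /T cmulZr !scalerDr !scalerA (mulrC k).
have Tyy : T (y ** y') = p ** y' by rewrite /T cmulA -cmulZl -cmulDl py.
have Ty : T y' = p + (4^-1)%:C *: ((s *i) *: y').
  by rewrite {1}yE TD TZ TB Tyy /T py [p ** y' + _]addrC addrK.
have -> : (3 / 4 * s) *i = s *i - (4^-1)%:C * s *i :> R[i].
  by apply/eqP; rewrite eq_complex/=; apply/andP; split; apply/eqP; field.
by rewrite scalerBl addrA -scalerA -/(T y') Ty addrK.
Qed.

Lemma resolvent_exists p (s : R) : star p = p -> 0 < s ->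
  exists2 s', 0 < s' <= s & exists y, resolvent p s' y.
Proof.
move=> sp s0; pose s_ n := (3/4) ^+ n * (rnorm p + 1).
have p1 : 0 < rnorm p + 1 by rewrite ltr_wpDl ?rnorm_ge0.
have s_gt0 n : 0 < s_ n by rewrite mulr_gt0// exprn_gt0//; lra.
have res n : exists y, resolvent p (s_ n) y.
  elim: n => [|n [y yP]].
    by apply: resolvent_large; rewrite /s_ mul1r ltrDl.
  by rewrite /s_ exprS -mulrA; exact: resolvent_shrink yP.
have [|||n nle] := @exprn_small R (3/4) (s / (rnorm p + 1)).
- by lra.
- by lra.
- by rewrite divr_gt0.
exists (s_ n) => //; rewrite s_gt0/= /s_ -ler_pdivlMr//.
Qed.

(** If y = p (p + i t)^-1 then p - p y = i t y; the adjoint of y is a left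
    approximate unit. *)
Lemma selfadjoint_approx_unit p (s : R) : star p = p -> 0 < s ->
  exists2 y, rnorm y <= 1 & rnorm (p - y ** p) <= s.
Proof.
move=> sp s0; have [t /andP[t0 ts] [y yP]] := resolvent_exists sp s0.
have y1 := cayley_le1 (resolvent_cayley sp t0 yP).
exists (star y); first by rewrite rnorm_star.
have -> : p - star y ** p = star (p - p ** y) by rewrite starB starM sp.
rewrite rnorm_star -{1}yP addrAC subrr add0r rnormZ rnorm_im//.
by rewrite (le_trans _ ts)// ler_piMr// ltW.
Qed.

(** Expanding the sum gives (1 - e) p (1 - e)^* with p = sum c c^*, so that it
    suffices to have an approximate unit for the selfadjoint element p. *)
Lemma approx_unit (r : seq A) (s : R) : 0 < s -> exists2 e, rnorm e <= 1 &
  rnorm (\sum_(c <- r) (c - e ** c) ** star (c - e ** c)) <= s.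
Proof.
move=> s0; pose p := \sum_(c <- r) c ** star c.
have sp : star p = p.
  rewrite /p; elim: r {p} => [|c r IH]; first by rewrite big_nil star0.
  by rewrite big_cons starD IH starM starK.
have [|e e1 pe] := selfadjoint_approx_unit (s := s / 2) sp; first by rewrite divr_gt0.
exists e => //.
have -> : \sum_(c <- r) (c - e ** c) ** star (c - e ** c) =
          (p - e ** p) - (p - e ** p) ** star e.
  rewrite cmulBl /p cmul_sumr cmul_suml cmul_suml -!sumrB; apply: eq_bigr => c _.
  by rewrite starB starM cmulBl !cmulBr !cmulA !opprD addrACA.
rewrite (le_trans (rnormB _ _))// [leRHS]splitr lerD//.
rewrite (le_trans (rnorm_cmul _ _))// rnorm_star -[leRHS]mulr1.
by rewrite ler_pM ?rnorm_ge0.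
Qed.

Lemma approx_unit1 c (s : R) : 0 < s -> exists2 e, rnorm e <= 1 &
  rnorm (c - e ** c) <= s.
Proof.
move=> s0; have [|e e1] := approx_unit [:: c] (s := s ^+ 2); first by rewrite exprn_gt0.
rewrite big_seq1 => ce; exists e => //.
rewrite -(@ler_pXn2r _ 2)// ?nnegrE ?rnorm_ge0 ?(ltW s0)//.
by rewrite -(rnorm_star (c - _)) -rnorm_star_cmul starK.
Qed.

End CStar.

(** It suffices to treat b selfadjoint with |b| < 1. With b^2 = 1 - (1 - h)^2 and
    c = f b, k = f h, the commuting selfadjoint elements c^2 and
    m = c (1 - k) satisfy c^4 + m^2 = c^2, hence |c|^4 <= |c|^2. *)
Lemma star_hom_contractive (R : realType) (G : lcGroupType) (A B : gcstarType R G)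
    (f : A -> B) a : star_hom f -> rnorm (f a) <= rnorm a.
Proof.
move=> [lf fM fS].
have ball b : star b = b -> rnorm b < 1 -> rnorm (f b) <= 1.
  move=> sb b1; have [|||h [sh bb bh]] := @sqrt_one_sub R A (cmul b b) b.
  - by rewrite starM sb.
  - by rewrite -{1}sb rnorm_star_cmul expr_lt1// rnorm_ge0.
  - by rewrite cmulA.
  set c := f b; set k := f h.
  have sc : star c = c by rewrite -fS sb.
  have sk : star k = k by rewrite -fS sh.
  have cc : cmul c c = k + k - cmul k k.
    by rewrite -fM bb (linear_funB lf) (linear_funD lf) fM.
  have ck : cmul c k = cmul k c by rewrite -!fM bh.
  pose m := c - cmul k c.
  have sm : star m = m by rewrite starB starM sc sk ck.
  have ccm : cmul (cmul c c) m = cmul m (cmul c c).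
    rewrite /m cmulBl cmulBr !cmulA; congr (_ - _).
    by rewrite -(cmulA c c k) ck cmulA ck.
  have mm : cmul (cmul c c) (cmul c c) + cmul m m = cmul c c.
    have -> : cmul m m = cmul c c - cmul (cmul c c) (cmul c c).
      have -> : cmul (cmul c c) (cmul c c) = cmul k (cmul c c) + cmul k (cmul c c)
          - cmul (cmul k k) (cmul c c) by rewrite {1}cc cmulBl cmulDl.
      rewrite /m cmulBl !cmulBr.
      have -> : cmul c (cmul k c) = cmul k (cmul c c) by rewrite cmulA ck cmulA.
      have -> : cmul (cmul k c) (cmul k c) = cmul (cmul k k) (cmul c c).
        by rewrite -cmulA (cmulA c) ck !cmulA.
      by rewrite -(cmulA k c c) !opprD !addrA.
    by rewrite addrC subrK.
  have := rnorm_le_sum_squares _ sm ccm; rewrite mm starM sc => /(_ erefl).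
  have -> : rnorm (cmul c c) = rnorm c ^+ 2 by rewrite -{1}sc rnorm_star_cmul.
  move=> c4; rewrite leNgt; apply/negP => c1.
  have c2 : 1 < rnorm c ^+ 2 by rewrite expr_gt1// rnorm_ge0.
  by move: c4; apply/negP; rewrite -ltNge expr2 ltr_pMl// (lt_trans ltr01).
have selfadj b : star b = b -> rnorm (f b) <= rnorm b.
  move=> sb; apply/ler_addgt0Pr => e e0; set t := rnorm b + e.
  have t0 : 0 < t by rewrite ltr_wpDl ?rnorm_ge0.
  have kt : rnorm (t^-1%:C : R[i]) = t^-1 by rewrite rnormR ger0_norm ?invr_ge0 ?ltW.
  have := ball (t^-1%:C *: b); rewrite (linear_funZ lf) !rnormZ kt mulrC.
  rewrite ltr_pdivrMr// mul1r ltrDl [_ * rnorm (f b)]mulrC ler_pdivrMr// mul1r.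
  by apply=> //; rewrite starZ sb conjcR.
rewrite -(@ler_pXn2r _ 2)// ?nnegrE ?rnorm_ge0// -!rnorm_star_cmul -fS -fM.
by apply: selfadj; rewrite starM starK.
Qed.

(** * Semi-inner products and their bounded functionals *)

Section ComplexComplete.
Context {R : realType}.

Lemma real_cauchy_limit (u : nat -> R) :
  (forall e : R, 0 < e -> exists N, forall n m, (N <= n)%N -> (N <= m)%N ->
    `|u n - u m| <= e) ->
  exists l, forall e : R, 0 < e -> exists N, forall n, (N <= n)%N -> `|u n - l| <= e.
Proof.
move=> cu.
have : cauchy (u @ \oo).
  apply/cauchyP => e e0; have [|N Nu] := cu (e / 2); first by rewrite divr_gt0.
  exists (u N); exists N => //= n /= Nn; rewrite -ball_normE/=.
  by apply: le_lt_trans (Nu _ _ _ _) _ => //; rewrite ltr_pdivrMr// ltr_pMr// ltr1n.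
move=> /R_complete /cvg_ex[l ul]; exists l => e e0.
have /cvgrPdist_lt/(_ _ e0)[N _ Nu] := ul.
by exists N => n Nn; have := Nu n Nn; rewrite distrC => /ltW.
Qed.

Lemma complex_cauchy_limit (u : nat -> R[i]) : rcauchy u -> exists l, rcvg u l.
Proof.
move=> cu.
have [a ua] : exists l, forall e : R, 0 < e -> exists N, forall n, (N <= n)%N ->
    `|complex.Re (u n) - l| <= e.
  apply: real_cauchy_limit => e /cu[N Nu]; exists N => n m Nn Nm.
  by rewrite -raddfB (le_trans (normr_Re_le _))// Nu.
have [b ub] : exists l, forall e : R, 0 < e -> exists N, forall n, (N <= n)%N ->
    `|complex.Im (u n) - l| <= e.
  apply: real_cauchy_limit => e /cu[N Nu]; exists N => n m Nn Nm.
  by rewrite -raddfB (le_trans (normr_Im_le _))// Nu.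
exists (a +i* b) => e e0.
have [|N Nu] := ua (e / 2); first by rewrite divr_gt0.
have [|M Mu] := ub (e / 2); first by rewrite divr_gt0.
exists (maxn N M) => n; rewrite geq_max => /andP[Nn Mn].
apply: le_trans (rnorm_le_ReIm _) _; rewrite [leRHS]splitr lerD//.
  by have := Nu n Nn; rewrite raddfB.
by have := Mu n Mn; rewrite raddfB.
Qed.

End ComplexComplete.

(** Semi-inner product spaces presented by formal sums: addition and scaling
    obey the module laws only as far as the form can see, so that sequences of
    elementary tensors, with concatenation as addition, present a tensor
    product. *)
Record prehilbert (R : realType) := PreHilbert {
  ph_car :> Type ;
  ph_pt : ph_car ;
  ph_add : ph_car -> ph_car -> ph_car ;
  ph_scale : R[i] -> ph_car -> ph_car ;
  form : ph_car -> ph_car -> R[i] ;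
  formDl : forall x y z, form (ph_add x y) z = form x z + form y z ;
  formZl : forall k x z, form (ph_scale k x) z = k * form x z ;
  formC : forall x y, form y x = (form x y)^*%C ;
  form_ge0 : forall x, 0 <= form x x
}.
Arguments ph_pt {R p}.
Arguments ph_add {R p}.
Arguments ph_scale {R p}.
Arguments form {R p}.

Record bounded_antilinear (R : realType) (P : prehilbert R) := BoundedAntilinear {
  afun :> P -> R[i] ;
  afunD : forall x y, afun (ph_add x y) = afun x + afun y ;
  afunZ : forall k x, afun (ph_scale k x) = k^*%C * afun x ;
  afun_bounded : exists K : R, forall x,
    rnorm (afun x) <= K * Num.sqrt (complex.Re (form x x))
}.

Section PreHilbert.
Context {R : realType} {P : prehilbert R}.
Implicit Types (x y z w : P) (k : R[i]).

Definition pnorm x : R := Num.sqrt (complex.Re (form x x)).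

Lemma formDr x y z : form z (ph_add x y) = form z x + form z y.
Proof. by rewrite formC formDl conjcD -!formC. Qed.

Lemma formZr k x z : form z (ph_scale k x) = k^*%C * form z x.
Proof. by rewrite formC formZl conjcM -formC. Qed.

Lemma pnorm_ge0 x : 0 <= pnorm x. Proof. exact: sqrtr_ge0. Qed.

Lemma Re_form_ge0 x : 0 <= complex.Re (form x x).
Proof. by have := form_ge0 x; rewrite lecE => /andP[]. Qed.

Lemma sqr_pnorm x : pnorm x ^+ 2 = complex.Re (form x x).
Proof. by rewrite sqr_sqrtr// Re_form_ge0. Qed.

Lemma form_pnorm x : form x x = (pnorm x ^+ 2)%:C.
Proof. by rewrite sqr_pnorm RRe_real// ger0_real// form_ge0. Qed.

Definition psub x y := ph_add x (ph_scale (-1) y).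

Lemma form_subl x y z : form (psub x y) z = form x z - form y z.
Proof. by rewrite formDl formZl mulN1r. Qed.

Lemma form_subr x y z : form z (psub x y) = form z x - form z y.
Proof. by rewrite formDr formZr conjcN conjc1 mulN1r. Qed.

Lemma quadratic_bound (a d b : R) : 0 <= d -> 0 <= b ->
  (forall t, 0 <= a - 2 * t * d + t ^+ 2 * d * b) -> d <= a * b.
Proof.
move=> d0 b0 q; have [b0'|b0'] := eqVneq b 0.
  rewrite b0' mulr0 leNgt; apply/negP => dpos.
  have := q ((a + 1) / (2 * d)); rewrite b0' mulr0 addr0.
  rewrite (_ : 2 * ((a + 1) / (2 * d)) * d = a + 1); first lra.
  by field; rewrite gt_eqF.
have bpos : 0 < b by rewrite lt0r b0'.
have := q b^-1; rewrite (_ : a - _ + _ = (a * b - d) / b); last by field.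
by rewrite pmulr_lge0 ?invr_gt0// subr_ge0.
Qed.

(** If z minimizes |w|^2 - 2 Re (F w) up to a, then < z | - > represents F up to
    the square root of a. To compare z with z + k w, take k to be a real
    multiple of the error at w. The case F = 0, a = |z|^2 is the Cauchy-Schwarz
    inequality. *)
Lemma almost_minimizer (F : P -> R[i]) z (a : R) :
  (forall x y, F (ph_add x y) = F x + F y) ->
  (forall k x, F (ph_scale k x) = k^*%C * F x) ->
  (forall w, complex.Re (form z z) - 2 * complex.Re (F z) <=
     complex.Re (form w w) - 2 * complex.Re (F w) + a) ->
  forall w, rnorm (F w - form z w) ^+ 2 <= a * pnorm w ^+ 2.
Proof.
move=> FD FZ zmin w; rewrite rdistC; set d := form z w - F w.
apply: quadratic_bound; rewrite ?sqr_ge0// => t.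
pose k : R[i] := - (t%:C * d).
have := zmin (ph_add z (ph_scale k w)).
rewrite formDl !formDr !formZl !formZr FD FZ.
have -> : form w z = (form z w)^*%C by rewrite -formC.
have kJ : k^*%C = - (t%:C * d^*%C) by rewrite /k conjcN conjcM conjcR.
have dd : d * d^*%C = (rnorm d ^+ 2)%:C by rewrite rnorm_sqr.
have -> : form z z + k^*%C * form z w + (k * (form z w)^*%C + k * (k^*%C * form w w)) =
  form z z + (k^*%C * form z w + (k^*%C * form z w)^*%C) + (t ^+ 2 * (rnorm d ^+ 2) * pnorm w ^+ 2)%:C.
  rewrite conjcM conjcK (form_pnorm w) kJ /k (rcM (t ^+ 2 * _)) (rcM (t ^+ 2)) -dd (rcX t).
  by ring.
rewrite !raddfD/= -/(complex.Re _).
have -> : complex.Re (k^*%C * form z w)^*%C = complex.Re (k^*%C * form z w).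
  by case: (_ * _).
have kd : complex.Re (k^*%C * form z w) - complex.Re (k^*%C * F w) = - t * rnorm d ^+ 2.
  rewrite -raddfB -mulrBr -/d kJ mulNr -mulrA mulrC [d^*%C * d]mulrC dd.
  by rewrite -rmorphM/= mulrC mulNr.
lra.
Qed.

Lemma cauchy_schwarz x y : rnorm (form x y) <= pnorm x * pnorm y.
Proof.
rewrite -(@ler_pXn2r _ 2)// ?nnegrE ?rnorm_ge0 ?mulr_ge0 ?pnorm_ge0//.
rewrite exprMn -(rnormN (form x y)) -[- form x y]add0r.
apply: (@almost_minimizer (fun=> 0)) => [a b|k a|w]; rewrite ?addr0 ?mulr0 ?subr0//.
by rewrite sqr_pnorm lerDr Re_form_ge0.
Qed.

Lemma antilinear_approx (F : P -> R[i]) (K e : R) :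
  (forall x y, F (ph_add x y) = F x + F y) ->
  (forall k x, F (ph_scale k x) = k^*%C * F x) ->
  (forall x, rnorm (F x) <= K * pnorm x) -> 0 < e ->
  exists z, forall w, rnorm (F w - form z w) <= e * pnorm w.
Proof.
move=> FD FZ FK e0.
pose J w := complex.Re (form w w) - 2 * complex.Re (F w).
have Jlb w : - K ^+ 2 <= J w.
  have := Re_le_rnorm (F w); have := FK w; rewrite /J -sqr_pnorm.
  by have := sqr_ge0 (pnorm w - K); nra.
pose S := [set J w | w in [set: P]].
have hS : has_inf S.
  split; first by exists (J ph_pt), ph_pt.
  by exists (- K ^+ 2) => _ [w _ <-].
have [|_ [z _ <-] zS] := @inf_adherent _ S (e ^+ 2) _ hS; first by rewrite exprn_gt0.
exists z => w.
rewrite -(@ler_pXn2r _ 2)// ?nnegrE ?rnorm_ge0 ?mulr_ge0 ?pnorm_ge0 ?(ltW e0)//.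
rewrite exprMn; apply: almost_minimizer => // v.
apply: (le_trans (ltW zS)); rewrite lerD2r; apply: ge_inf; last by exists v.
by exists (- K ^+ 2) => _ [u _ <-].
Qed.

Lemma pnormZ k x : pnorm (ph_scale k x) = rnorm k * pnorm x.
Proof.
rewrite /pnorm formZl formZr mulrA -rnorm_sqr.
have -> (r : R) (y : R[i]) : complex.Re (r%:C * y) = r * complex.Re y.
  by case: y => a b /=; rewrite mul0r subr0.
by rewrite sqrtrM ?sqr_ge0// sqrtr_sqr ger0_norm ?rnorm_ge0.
Qed.

End PreHilbert.

(** * The Hilbert space of bounded antilinear functionals *)

Section DualModule.
Context {R : realType} {P : prehilbert R}.
Local Notation D := (bounded_antilinear P).
Implicit Types (F G : D) (k : R[i]).

Lemma afun_inj F G : (forall x, F x = G x) -> F = G.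
Proof.
case: F G => [f fD fZ fB] [g gD gZ gB]/= fg.
have {}fg : f = g by apply/funext.
subst g; congr BoundedAntilinear; exact: Prop_irrelevance.
Qed.

HB.instance Definition _ := gen_eqMixin D.
HB.instance Definition _ := gen_choiceMixin D.

Lemma afun_add_subproof F G :
  exists K : R, forall x, rnorm (F x + G x) <= K * Num.sqrt (complex.Re (form x x)).
Proof.
have [K FK] := afun_bounded F; have [L GL] := afun_bounded G.
by exists (K + L) => x; rewrite (le_trans (rnormD _ _))// mulrDl lerD.
Qed.

Lemma afun_scale_subproof k F :
  exists K : R, forall x, rnorm (k * F x) <= K * Num.sqrt (complex.Re (form x x)).
Proof.
have [K FK] := afun_bounded F.
by exists (rnorm k * K) => x; rewrite rnormM -mulrA ler_wpM2l ?rnorm_ge0.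
Qed.

Definition afun_add F G : D.
Proof.
apply: (@BoundedAntilinear R P (fun x => F x + G x) _ _ (afun_add_subproof F G)).
  by move=> x y; rewrite !afunD addrACA.
by move=> k x; rewrite !afunZ mulrDr.
Defined.

Definition afun_scale k F : D.
Proof.
apply: (@BoundedAntilinear R P (fun x => k * F x) _ _ (afun_scale_subproof k F)).
  by move=> x y; rewrite !afunD mulrDr.
by move=> l x; rewrite !afunZ mulrCA.
Defined.

Definition afun_opp F : D := afun_scale (-1) F.

Definition riesz (z : P) : D.
Proof.
apply: (@BoundedAntilinear R P (form z)) => [x y|k x|]; first exact: formDr.
  exact: formZr.
by exists (pnorm z) => x; exact: cauchy_schwarz.
Defined.

Definition afun_zero : D := afun_scale 0 (riesz ph_pt).

Lemma afun_addA : associative afun_add.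
Proof. by move=> F G H; apply: afun_inj => x /=; rewrite addrA. Qed.
Lemma afun_addC : commutative afun_add.
Proof. by move=> F G; apply: afun_inj => x /=; rewrite addrC. Qed.
Lemma afun_add0 : left_id afun_zero afun_add.
Proof. by move=> F; apply: afun_inj => x /=; rewrite mul0r add0r. Qed.
Lemma afun_addN : left_inverse afun_zero afun_opp afun_add.
Proof. by move=> F; apply: afun_inj => x /=; rewrite mul0r mulN1r addNr. Qed.

HB.instance Definition _ :=
  GRing.isZmodule.Build D afun_addA afun_addC afun_add0 afun_addN.

Lemma afun_scaleA k l F : afun_scale k (afun_scale l F) = afun_scale (k * l) F.
Proof. by apply: afun_inj => x /=; rewrite mulrA. Qed.
Lemma afun_scale1 : left_id 1 afun_scale.
Proof. by move=> F; apply: afun_inj => x /=; rewrite mul1r. Qed.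
Lemma afun_scaleDr : right_distributive afun_scale +%R.
Proof. by move=> k F G; apply: afun_inj => x /=; rewrite mulrDr. Qed.
Lemma afun_scaleDl F : {morph afun_scale^~ F : k l / k + l}.
Proof. by move=> k l; apply: afun_inj => x /=; rewrite mulrDl. Qed.

HB.instance Definition _ := GRing.Zmodule_isLmodule.Build R[i] D
  afun_scaleA afun_scale1 afun_scaleDr afun_scaleDl.

Lemma add_afunE F G x : (F + G) x = F x + G x. Proof. by []. Qed.
Lemma scale_afunE k F x : (k *: F) x = k * F x. Proof. by []. Qed.
Lemma zero_afunE x : (0 : D) x = 0. Proof. exact: mul0r. Qed.
Lemma opp_afunE F x : (- F) x = - F x. Proof. exact: mulN1r. Qed.

Definition afun_norm F : R :=
  inf [set K : R | 0 <= K /\ forall x, rnorm (F x) <= K * pnorm x].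

Lemma afun_norm_has_inf F :
  has_inf [set K : R | 0 <= K /\ forall x, rnorm (F x) <= K * pnorm x].
Proof.
split; last by exists 0 => K [].
have [K FK] := afun_bounded F; exists `|K|; split=> // x.
by rewrite (le_trans (FK x))// ler_wpM2r ?pnorm_ge0// ler_norm.
Qed.

Lemma afun_norm_ge0 F : 0 <= afun_norm F.
Proof. by apply: lb_le_inf => [|K []//]; case: (afun_norm_has_inf F). Qed.

Lemma le_afun_norm F x : rnorm (F x) <= afun_norm F * pnorm x.
Proof.
apply/ler_addgt0Pl => e e0.
have p1 : 0 < pnorm x + 1 by rewrite ltr_wpDl ?pnorm_ge0.
have [|K [K0 FK] Ke] := @inf_adherent _ _ (e / (pnorm x + 1)) _ (afun_norm_has_inf F).
  by rewrite divr_gt0.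
rewrite (le_trans (FK x))// (@le_trans _ _ ((afun_norm F + e / (pnorm x + 1)) * pnorm x))//.
  by rewrite ler_wpM2r ?pnorm_ge0// ltW.
rewrite mulrDl addrC lerD2r mulrAC ler_pdivrMr// ler_wpM2l ?(ltW e0)//.
by rewrite lerDl.
Qed.

Lemma afun_norm_le F (K : R) : 0 <= K -> (forall x, rnorm (F x) <= K * pnorm x) ->
  afun_norm F <= K.
Proof.
move=> K0 FK; apply: ge_inf; last by [].
by case: (afun_norm_has_inf F).
Qed.

Definition afun_cnorm F : R[i] := (afun_norm F)%:C.

Lemma afun_cnormD F G : afun_cnorm (F + G) <= afun_cnorm F + afun_cnorm G.
Proof.
rewrite -[_ + afun_cnorm G]rmorphD/= lecR; apply: afun_norm_le => [|x].
  by rewrite addr_ge0 ?afun_norm_ge0.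
by rewrite (le_trans (rnormD _ _))// mulrDl lerD// le_afun_norm.
Qed.

Lemma afun_cnormZ k F : afun_cnorm (k *: F) = `|k| * afun_cnorm F.
Proof.
have le l H : afun_norm (l *: H) <= rnorm l * afun_norm H.
  apply: afun_norm_le => [|x]; first by rewrite mulr_ge0 ?rnorm_ge0 ?afun_norm_ge0.
  by rewrite scale_afunE rnormM -mulrA ler_wpM2l ?rnorm_ge0 ?le_afun_norm.
rewrite rnormE /afun_cnorm -rcM; congr (_%:C); apply/le_anti; rewrite le/=.
have [->|k0] := eqVneq k 0; first by rewrite rnorm0 mul0r afun_norm_ge0.
have kpos : 0 < rnorm k.
  rewrite lt0r rnorm_ge0 andbT; apply: contra k0 => /eqP/rnorm0_eq0/eqP//.
rewrite -{1}[F]scale1r -(mulVf k0) -scalerA.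
rewrite (le_trans (ler_wpM2l (ltW kpos) (le _ _)))// mulrA -rnormM mulfV//.
by rewrite rnorm1 mul1r.
Qed.

Lemma afun_cnorm0_eq0 F : afun_cnorm F = 0 -> F = 0.
Proof.
move=> [F0]; apply: afun_inj => x; rewrite zero_afunE; apply: rnorm0_eq0; apply/eqP.
by rewrite eq_le rnorm_ge0 andbT (le_trans (le_afun_norm F x))// F0 mul0r.
Qed.

HB.instance Definition _ := Lmodule_isNormed.Build R[i] D
  afun_cnormD afun_cnormZ afun_cnorm0_eq0.

Lemma afun_rnorm_le F x : rnorm (F x) <= rnorm F * pnorm x.
Proof. exact: le_afun_norm. Qed.

Lemma rnorm_afun_le F (K : R) : 0 <= K -> (forall x, rnorm (F x) <= K * pnorm x) ->
  rnorm F <= K.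
Proof. exact: afun_norm_le. Qed.

Lemma sub_afunE F G x : (F - G) x = F x - G x.
Proof. by rewrite add_afunE opp_afunE. Qed.

Lemma afun_seq_complete (u : nat -> D) :
  (forall n m, rnorm (u n - u m) <= n.+1%:R^-1 + m.+1%:R^-1) ->
  exists F, forall n, rnorm (u n - F) <= n.+1%:R^-1.
Proof.
move=> cu.
have ucv (e c : R) : 0 < e -> 0 <= c -> exists N, forall n, (N <= n)%N -> n.+1%:R^-1 * c <= e.
  move=> e0 c0; have [N cN] : exists N, c / e <= N.+1%:R.
    exists (Num.truncn (c / e)); rewrite ltW//; exact: truncnS_gt.
  exists N => n Nn; rewrite mulrC ler_pdivrMr// mulrC -ler_pdivrMr//.
  by rewrite (le_trans cN)// ler_nat.
have /choice[f fP] x : exists l, rcvg (fun n => u n x) l.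
  apply: complex_cauchy_limit => e e0.
  have [||N NP] := ucv (e / 2) (pnorm x); rewrite ?divr_gt0 ?pnorm_ge0//.
  exists N => n m Nn Nm; rewrite -sub_afunE (le_trans (afun_rnorm_le _ _))//.
  rewrite (le_trans (ler_wpM2r (pnorm_ge0 _) (cu _ _)))// mulrDl [leRHS]splitr.
  by rewrite lerD// NP.
have fu n x : rnorm (u n x - f x) <= n.+1%:R^-1 * pnorm x.
  apply/ler_addgt0Pl => e e0.
  have [|N NP] := fP x (e / 2); first by rewrite divr_gt0.
  have [||M MP] := ucv (e / 2) (pnorm x); rewrite ?divr_gt0 ?pnorm_ge0//.
  pose m := maxn N M.
  have umf := NP m (leq_maxl _ _); have mM := MP m (leq_maxr _ _).
  have unm : rnorm (u n x - u m x) <= (n.+1%:R^-1 + m.+1%:R^-1) * pnorm x.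
    rewrite -sub_afunE (le_trans (afun_rnorm_le _ _))//.
    by rewrite ler_wpM2r ?pnorm_ge0// cu.
  have := rdistD (u m x) (u n x) (f x); rewrite mulrDl in unm.
  by move: unm mM umf; set a := _ * pnorm x; set b := _ * pnorm x; lra.
have lim0 (z : R[i]) (c : R) : 0 <= c -> (forall n, rnorm z <= n.+1%:R^-1 * c) -> z = 0.
  move=> c0 zc; apply: rnorm_le0_eq0 => e /ucv/(_ c0)[N /(_ N (leqnn N))].
  exact: le_trans.
have fD x y : f (ph_add x y) = f x + f y.
  apply/eqP; rewrite -subr_eq0; apply/eqP.
  apply: (lim0 _ (pnorm (ph_add x y) + (pnorm x + pnorm y))) => [|n].
    by rewrite !addr_ge0 ?pnorm_ge0.
  rewrite (le_trans (rdistD (u n (ph_add x y)) _ _))// mulrDr lerD//.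
    by rewrite rdistC.
  rewrite afunD opprD addrACA (le_trans (rnormD _ _))// mulrDr lerD//.
have fZ k x : f (ph_scale k x) = k^*%C * f x.
  apply/eqP; rewrite -subr_eq0; apply/eqP.
  apply: (lim0 _ (pnorm (ph_scale k x) + rnorm k * pnorm x)) => [|n].
    by rewrite addr_ge0 ?mulr_ge0 ?pnorm_ge0 ?rnorm_ge0.
  rewrite (le_trans (rdistD (u n (ph_scale k x)) _ _))// mulrDr lerD//.
    by rewrite rdistC.
  by rewrite afunZ -mulrBr rnormM rnormJ mulrCA ler_wpM2l ?rnorm_ge0.
have fB : exists K, forall x, rnorm (f x) <= K * Num.sqrt (complex.Re (form x x)).
  exists (rnorm (u 0%N) + 1) => x; rewrite -/(pnorm x).
  rewrite -[f x](subKr (u 0%N x)) (le_trans (rnormB _ _))// mulrDl lerD ?afun_rnorm_le//.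
  by have := fu 0%N x; rewrite invr1.
exists (BoundedAntilinear fD fZ fB) => n; apply: rnorm_afun_le => [//|x].
by rewrite sub_afunE.
Qed.

Lemma afun_complete (Phi : set_system D) : ProperFilter Phi -> cauchy Phi -> cvg Phi.
Proof.
move=> PF /cauchyP cPhi.
have /choice[u uP] (n : nat) : exists F, Phi [set G | rnorm (F - G) <= (2 * n.+1%:R)^-1].
  have e0 : 0 < ((2 * n.+1%:R)^-1)%:C :> R[i] by rewrite ltcR invr_gt0 mulr_gt0.
  have [F PhiF] := cPhi _ e0; exists F; apply: filterS PhiF => G.
  by rewrite -ball_normE/= rnormE ltcR => /ltW.
have [n m|F uF] := afun_seq_complete (u := u).
  have [G [uG vG]] := filter_ex (filterI (uP n) (uP m)).
  rewrite (le_trans (rdistD G _ _))// (rdistC G) lerD//.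
    by rewrite (le_trans uG)// lef_pV2 ?posrE ?mulr_gt0// ler_peMl// ler1n.
  by rewrite (le_trans vG)// lef_pV2 ?posrE ?mulr_gt0// ler_peMl// ler1n.
apply/cvg_ex; exists F; apply/cvgrPdist_le => e /rnorm_gt0c[r r0 ->].
have [N rN] : exists N : nat, 2 / r <= N.+1%:R :> R.
  by exists (Num.truncn (2 / r)); rewrite ltW//; exact: truncnS_gt.
apply: filterS (uP N) => G uG; rewrite rnormE lecR.
rewrite (le_trans (rdistD (u N) _ _))// rdistC (le_trans (lerD (uF N) uG))//.
have N0 : 0 < N.+1%:R :> R by [].
have : 2 * N.+1%:R^-1 <= r.
  by rewrite ler_pdivrMr// mulrC -ler_pdivrMr.
have : 0 <= N.+1%:R^-1 :> R by rewrite invr_ge0.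
by rewrite invfM; set a := N.+1%:R^-1; lra.
Qed.

HB.instance Definition _ := Uniform_isComplete.Build D afun_complete.

End DualModule.

Section DualHilbert.
Context {R : realType} {P : prehilbert R}.
Local Notation D := (bounded_antilinear P).
Implicit Types (F G : D) (k : R[i]).

Lemma riesz_approx F (e : R) : 0 < e -> exists z, rnorm (F - riesz z) <= e.
Proof.
move=> e0; have [z zF] := antilinear_approx (afunD F) (afunZ F) (afun_rnorm_le F) e0.
exists z; apply: rnorm_afun_le => [|x]; first exact: ltW.
by rewrite sub_afunE.
Qed.

Lemma rnorm_riesz (z : P) : rnorm (riesz z) = pnorm z.
Proof.
apply/le_anti/andP; split.
  by apply: rnorm_afun_le => [|x]; rewrite ?pnorm_ge0 ?cauchy_schwarz.
have [->|z0] := eqVneq (pnorm z) 0; first exact: rnorm_ge0.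
have zpos : 0 < pnorm z by rewrite lt0r z0 pnorm_ge0.
rewrite -(ler_pM2r zpos) (le_trans _ (afun_rnorm_le _ _))//= form_pnorm rnormR.
by rewrite expr2 ler_norm.
Qed.

Lemma riesz_sub x y : riesz (psub x y) = riesz x - riesz y :> D.
Proof. by apply: afun_inj => w; rewrite sub_afunE/= form_subl. Qed.

Lemma afun_sub F x y : F (psub x y) = F x - F y.
Proof. by rewrite afunD afunZ conjcN conjc1 mulN1r. Qed.

(** As the represented functionals are dense, < F | G > is the limit of F z for
    < z | - > tending to G. The estimate determines it. *)
Lemma afun_inner_exists F G :
  exists c, forall z, rnorm (c - F z) <= rnorm F * rnorm (G - riesz z).
Proof.
have /choice[u uG] (n : nat) : exists z, rnorm (G - riesz z) <= n.+1%:R^-1.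
  by apply: riesz_approx; rewrite invr_gt0.
have small (e : R) : 0 < e -> exists N, forall n, (N <= n)%N -> rnorm F * n.+1%:R^-1 <= e.
  move=> e0; exists (Num.truncn (rnorm F / e)) => n Nn.
  rewrite ler_pdivrMr// mulrC -ler_pdivrMr// (le_trans (ltW (truncnS_gt _)))//.
  by rewrite ler_nat.
have Fu z w : rnorm (F z - F w) <= rnorm F * rnorm (G - riesz z) + rnorm F * rnorm (G - riesz w).
  rewrite -afun_sub (le_trans (afun_rnorm_le _ _))// -rnorm_riesz riesz_sub -mulrDr.
  by rewrite ler_wpM2l ?rnorm_ge0// (le_trans (rdistD G _ _))// (rdistC _ G).
have uF n : rnorm F * rnorm (G - riesz (u n)) <= rnorm F * n.+1%:R^-1.
  by rewrite ler_wpM2l ?rnorm_ge0.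
have [|c uc] := @complex_cauchy_limit R (fun n => F (u n)).
  move=> e e0; have [|N NP] := small (e / 2); first by rewrite divr_gt0.
  exists N => n m Nn Nm; rewrite (le_trans (Fu _ _))// [leRHS]splitr.
  by rewrite lerD// (le_trans (uF _))// NP.
exists c => z; apply/ler_addgt0Pl => e e0.
have [|N NP] := small (e / 2); first by rewrite divr_gt0.
have [|M MP] := uc (e / 2); first by rewrite divr_gt0.
pose m := maxn N M; have := MP m (leq_maxr _ _); have := NP m (leq_maxl _ _).
have := Fu (u m) z; have := uF m; have := rdistD (F (u m)) c (F z).
rewrite (rdistC c (F (u m))); set a := _ * m.+1%:R^-1; lra.
Qed.

Definition afun_inner F G : R[i] := sval (cid (afun_inner_exists F G)).

Lemma afun_innerP F G z :
  rnorm (afun_inner F G - F z) <= rnorm F * rnorm (G - riesz z).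
Proof. by rewrite /afun_inner; case: cid. Qed.

Lemma afun_inner_unique F G c (C : R) :
  (forall (e : R), 0 < e -> e <= 1 -> exists2 z,
     rnorm (G - riesz z) <= e & rnorm (c - F z) <= C * e) ->
  afun_inner F G = c.
Proof.
move=> cF; apply/eqP; rewrite -subr_eq0; apply/eqP.
apply: (@rnorm_le0_scale _ _ _ (rnorm F + C)) => e e0 e1.
have [z zG zc] := cF e e0 e1.
rewrite (le_trans (rdistD (F z) _ _))// mulrDl lerD 1?(rdistC _ c)//.
by rewrite (le_trans (afun_innerP _ _ _))// ler_wpM2l ?rnorm_ge0.
Qed.

Lemma afun_inner_riesz F z : afun_inner F (riesz z) = F z.
Proof.
apply: (@afun_inner_unique _ _ _ 0) => e e0 _; exists z.
  by rewrite subrr rnorm0 ltW.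
by rewrite subrr rnorm0 mul0r.
Qed.

Lemma afun_inner_linear k F G H :
  afun_inner (k *: F + G) H = k * afun_inner F H + afun_inner G H.
Proof.
apply: (@afun_inner_unique _ _ _ (rnorm k * rnorm F + rnorm G)) => e e0 _.
have [z zH] := riesz_approx H e0; exists z => //.
rewrite add_afunE scale_afunE opprD addrACA -mulrBr (le_trans (rnormD _ _))//.
have le E : rnorm (afun_inner E H - E z) <= rnorm E * e.
  by rewrite (le_trans (afun_innerP _ _ _))// ler_wpM2l ?rnorm_ge0.
by rewrite mulrDl lerD// rnormM -mulrA ler_wpM2l ?rnorm_ge0.
Qed.

Lemma rnorm_riesz_le F z (e : R) : rnorm (F - riesz z) <= e -> pnorm z <= rnorm F + e.
Proof.
move=> Fz; rewrite -rnorm_riesz -[riesz z](subKr F) (le_trans (rnormB _ _))//.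
by rewrite lerD2l.
Qed.

Lemma afun_inner_form F G z w (e : R) : 0 <= e -> e <= 1 ->
  rnorm (F - riesz z) <= e -> rnorm (G - riesz w) <= e ->
  rnorm (afun_inner F G - form z w) <= (rnorm F + rnorm G + 1) * e.
Proof.
move=> e0 e1 Fz Gw; rewrite (le_trans (rdistD (F w) _ _))// -addrA mulrDl lerD//.
  by rewrite (le_trans (afun_innerP _ _ _))// ler_wpM2l ?rnorm_ge0.
have -> : F w - form z w = (F - riesz z) w by rewrite sub_afunE.
rewrite (le_trans (afun_rnorm_le _ _))// mulrC ler_pM ?pnorm_ge0 ?rnorm_ge0//.
by rewrite (le_trans (rnorm_riesz_le Gw))// lerD2l.
Qed.

Lemma afun_inner_conj F G : afun_inner G F = (afun_inner F G)^*%C.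
Proof.
apply/eqP; rewrite -subr_eq0; apply/eqP.
pose C := rnorm F + rnorm G + 1.
apply: (@rnorm_le0_scale _ _ _ (C + C)) => e e0 e1.
have [z zF] := riesz_approx F e0; have [w wG] := riesz_approx G e0.
rewrite (le_trans (rdistD (form w z) _ _))// mulrDl lerD//.
  by rewrite /C (addrC (rnorm F)) afun_inner_form// ltW.
rewrite formC -rnormN opprB -[_ - _](_ : (afun_inner F G - form z w)^*%C = _).
  by rewrite rnormJ afun_inner_form// ltW.
by rewrite conjcD conjcN.
Qed.

Lemma afun_inner_norm F : afun_inner F F = `|F| ^+ 2.
Proof.
apply/eqP; rewrite -subr_eq0; apply/eqP.
pose C := rnorm F + rnorm F + 1.
apply: (@rnorm_le0_scale _ _ _ (C + C)) => e e0 e1.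
have [z zF] := riesz_approx F e0.
rewrite (le_trans (rdistD (form z z) _ _))// mulrDl lerD//.
  by rewrite afun_inner_form// ltW.
rewrite form_pnorm rnormE -rcX -rmorphB rnormR subr_sqr normrM mulrC ler_pM//.
  have := rnorm_riesz_le zF; have := rnorm_ge0 F; have := pnorm_ge0 z.
  by move=> *; rewrite ger0_norm /C; lra.
rewrite -rnorm_riesz ler_norml; apply/andP; split.
  have := rdistD (riesz z) F 0; rewrite !subr0; lra.
by have := rdistD F (riesz z) 0; rewrite !subr0 rdistC; lra.
Qed.

HB.instance Definition _ := CompleteNormedModule_isHilbert.Build R D
  afun_inner_linear afun_inner_conj afun_inner_norm.

Lemma inner_riesz F z : inner F (riesz z) = F z.
Proof. exact: afun_inner_riesz. Qed.

Lemma inner_afunP F G z : rnorm (inner F G - F z) <= rnorm F * rnorm (G - riesz z).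
Proof. exact: afun_innerP. Qed.

End DualHilbert.

Section HilbertPrehilbert.
Context {R : realType}.
Implicit Types H : hilbertType R.

Lemma innerDl H (x y z : H) : inner (x + y) z = inner x z + inner y z.
Proof. by have := inner_linear 1 x y z; rewrite scale1r mul1r. Qed.
Lemma inner0l H (z : H) : inner 0 z = 0.
Proof. by apply: (@addrI _ (inner 0 z)); rewrite -innerDl !addr0. Qed.
Lemma innerZl H k (x z : H) : inner (k *: x) z = k * inner x z.
Proof. by have := inner_linear k x 0 z; rewrite inner0l !addr0. Qed.
Lemma inner_ge0 H (x : H) : 0 <= inner x x.
Proof. by rewrite inner_norm exprn_ge0. Qed.

Definition hilbert_form (H : hilbertType R) : prehilbert R :=
  @PreHilbert R H 0 (fun x y => x + y) (fun k x => k *: x) (@inner R H)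
    (@innerDl H) (@innerZl H) (@inner_conj R H) (@inner_ge0 H).

Lemma pnorm_hilbert H (x : hilbert_form H) : pnorm x = rnorm (x : H).
Proof.
rewrite /pnorm/= inner_norm rnormE -rcX/=.
by rewrite sqrtr_sqr ger0_norm ?rnorm_ge0.
Qed.

Lemma innerDr H (x y z : H) : inner z (x + y) = inner z x + inner z y.
Proof. exact: (@formDr R (hilbert_form H)). Qed.
Lemma innerZr H k (x z : H) : inner z (k *: x) = k^*%C * inner z x.
Proof. exact: (@formZr R (hilbert_form H)). Qed.
Lemma innerNr H (x z : H) : inner z (- x) = - inner z x.
Proof. by rewrite -scaleN1r innerZr conjcN conjc1 mulN1r. Qed.
Lemma innerNl H (x z : H) : inner (- x) z = - inner x z.
Proof. by rewrite -scaleN1r innerZl mulN1r. Qed.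
Lemma innerBl H (x y z : H) : inner (x - y) z = inner x z - inner y z.
Proof. by rewrite innerDl innerNl. Qed.
Lemma innerBr H (x y z : H) : inner z (x - y) = inner z x - inner z y.
Proof. by rewrite innerDr innerNr. Qed.
Lemma inner0r H (z : H) : inner z 0 = 0.
Proof. by rewrite inner_conj inner0l conjc0. Qed.
Lemma inner_suml H (I : Type) (r : seq I) (F : I -> H) z :
  inner (\sum_(i <- r) F i) z = \sum_(i <- r) inner (F i) z.
Proof. by elim/big_ind2 : _ => [|x y w t <- <-|//]; rewrite ?inner0l ?innerDl. Qed.
Lemma inner_sumr H (I : Type) (r : seq I) (F : I -> H) z :
  inner z (\sum_(i <- r) F i) = \sum_(i <- r) inner z (F i).
Proof. by elim/big_ind2 : _ => [|x y w t <- <-|//]; rewrite ?inner0r ?innerDr. Qed.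

Lemma rnorm_inner H (x y : H) : rnorm (inner x y) <= rnorm x * rnorm y.
Proof.
by have := @cauchy_schwarz R (hilbert_form H) x y; rewrite !pnorm_hilbert.
Qed.

Lemma sqr_rnorm H (x : H) : rnorm x ^+ 2 = complex.Re (inner x x).
Proof. by rewrite -pnorm_hilbert sqr_pnorm. Qed.

Lemma rnorm_le_inner H (x : H) (K : R) : 0 <= K ->
  (forall y, rnorm (inner x y) <= K * rnorm y) -> rnorm x <= K.
Proof.
move=> K0 xK; have [->|x0] := eqVneq (rnorm x) 0; first by [].
have xpos : 0 < rnorm x by rewrite lt0r x0 rnorm_ge0.
rewrite -(ler_pM2r xpos) -expr2 sqr_rnorm (le_trans (Re_le_rnorm _))//.
Qed.

Lemma inner_eq H (x y : H) : (forall z, inner x z = inner y z) -> x = y.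
Proof.
move=> xy; apply/eqP; rewrite -subr_eq0; apply/eqP/rnorm0_eq0/eqP.
by rewrite -(@sqrf_eq0 R) sqr_rnorm innerBl xy subrr.
Qed.

Lemma riesz_representation H (F : H -> R[i]) (K : R) :
  (forall x y, F (x + y) = F x + F y) -> (forall k x, F (k *: x) = k^*%C * F x) ->
  (forall x, rnorm (F x) <= K * rnorm x) -> exists z, forall x, F x = inner z x.
Proof.
move=> FD FZ FK.
have FK' (x : hilbert_form H) : rnorm (F x) <= K * pnorm x by rewrite pnorm_hilbert.
have ap (e : R) : 0 < e -> exists z, forall w, rnorm (F w - inner z w) <= e * rnorm w.
  move=> e0; have [z zF] := @antilinear_approx R (hilbert_form H) F K e FD FZ FK' e0.
  by exists z => w; have := zF w; rewrite pnorm_hilbert.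
have /choice[u uF] (n : nat) : exists z, forall w,
    rnorm (F w - inner z w) <= n.+1%:R^-1 * rnorm w.
  by apply: ap; rewrite invr_gt0.
have small (e : R) : 0 < e -> exists N, forall n, (N <= n)%N -> n.+1%:R^-1 <= e.
  move=> e0; exists (Num.truncn e^-1) => n Nn.
  rewrite -[e]invrK lef_pV2 ?posrE ?invr_gt0// (le_trans (ltW (truncnS_gt _)))//.
  by rewrite ler_nat.
have [|z uz] := @rcauchy_rcvg R H u.
  move=> e e0; have [|N NP] := small (e / 2); first by rewrite divr_gt0.
  exists N => n m Nn Nm; apply: rnorm_le_inner => [|w]; first exact: ltW.
  rewrite innerBl -rnormN opprB (le_trans (rdistD (F w) _ _))//.
  rewrite (rdistC _ (F w)) [e in leRHS]splitr mulrDl lerD//.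
    by rewrite (le_trans (uF _ _))// ler_wpM2r ?rnorm_ge0// NP.
  by rewrite (le_trans (uF _ _))// ler_wpM2r ?rnorm_ge0// NP.
exists z => x; apply/eqP; rewrite -subr_eq0; apply/eqP.
apply: (@rnorm_le0_scale _ _ _ (rnorm x + rnorm x)) => e e0 _.
have [N NP] := small e e0; have [M MP] := uz e e0; pose m := maxn N M.
rewrite (le_trans (rdistD (inner (u m) x) _ _))// mulrDl lerD// mulrC.
  by rewrite (le_trans (uF _ _))// ler_wpM2r ?rnorm_ge0// NP// leq_maxl.
rewrite -innerBl (le_trans (rnorm_inner _ _))// ler_wpM2r ?rnorm_ge0//.
by rewrite MP// leq_maxr.
Qed.

End HilbertPrehilbert.

(** * Bounded operators between prehilbert spaces *)

Record bounded_map (R : realType) (P Q : prehilbert R) := BoundedMap {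
  bmap :> P -> Q ;
  bmapD : forall x y, bmap (ph_add x y) = ph_add (bmap x) (bmap y) ;
  bmapZ : forall k x, bmap (ph_scale k x) = ph_scale k (bmap x) ;
  bmap_bounded : exists2 K : R, 0 <= K & forall x, pnorm (bmap x) <= K * pnorm x
}.

Section Pullback.
Context {R : realType} {P Q : prehilbert R}.
Implicit Types (S : bounded_map P Q).

Definition pullback S (F : bounded_antilinear Q) : bounded_antilinear P.
Proof.
apply: (@BoundedAntilinear R P (F \o S)) => [x y|k x|]/=.
- by rewrite bmapD afunD.
- by rewrite bmapZ afunZ.
have [K K0 SK] := bmap_bounded S; exists (rnorm F * K) => x.
by rewrite (le_trans (afun_rnorm_le _ _))// -mulrA ler_wpM2l ?rnorm_ge0// SK.
Defined.

Lemma pullback_linear S : linear (pullback S).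
Proof. by move=> k F G; apply: afun_inj. Qed.

Lemma pullbackB S F G : pullback S (F - G) = pullback S F - pullback S G.
Proof.
by apply: afun_inj => x; rewrite [RHS]sub_afunE; exact: (sub_afunE F G (S x)).
Qed.

Lemma pullback_le S (K : R) F : 0 <= K -> (forall x, pnorm (S x) <= K * pnorm x) ->
  rnorm (pullback S F) <= K * rnorm F.
Proof.
move=> K0 SK; apply: rnorm_afun_le => [|x]; first by rewrite mulr_ge0 ?rnorm_ge0.
by rewrite (le_trans (afun_rnorm_le F (S x)))// [K * _]mulrC -mulrA ler_wpM2l ?rnorm_ge0.
Qed.

End Pullback.

Section Adjoint.
Context {R : realType} {P : prehilbert R}.
Implicit Types (S T : bounded_map P P) (F G : bounded_antilinear P).

Lemma pullback_riesz S T z : (forall x y, form (S x) y = form x (T y)) ->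
  pullback T (riesz z) = riesz (S z).
Proof. by move=> ST; apply: afun_inj => x /=; rewrite ST. Qed.

(** Pullback along T is the continuous extension of S to functionals. *)
Lemma inner_pullback S T F G : (forall x y, form (S x) y = form x (T y)) ->
  inner (pullback T F) G = inner F (pullback S G).
Proof.
move=> ST; have TS x y : form (T x) y = form x (S y).
  by rewrite formC -ST -formC.
have [K K0 SK] := bmap_bounded S.
apply: (@afun_inner_unique _ _ _ _ _ (rnorm F * K)) => e e0 _.
have [z zG] := riesz_approx G e0; exists z => //=.
rewrite (le_trans (inner_afunP _ _ _))// -mulrA ler_wpM2l ?rnorm_ge0//.
rewrite -(pullback_riesz _ TS) -pullbackB (le_trans (pullback_le _ K0 SK))//.
by rewrite ler_wpM2l.
Qed.

End Adjoint.

Section StarRep.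
Context {R : realType} {A : cstarType R} {P : prehilbert R} (op : A -> P -> P).
Context (op_star : forall a x y, form (op a x) y = form x (op (star a) y)).
Context (op_mul : forall a b x y, form (op (cmul a b) x) y = form (op a (op b x)) y).
Context (opD : forall a b x y, form (op (a + b) x) y = form (op a x) y + form (op b x) y).
Context (opZ : forall k a x y, form (op (k *: a) x) y = k * form (op a x) y).

(** For |a| < 1 the operator 1 - a^* a is positive, as it is the square of the
    selfadjoint operator 1 - h. *)
Lemma star_rep_contractive c x : pnorm (op c x) <= rnorm c * pnorm x.
Proof.
have opB a b y z : form (op (a - b) y) z = form (op a y) z - form (op b y) z.
  by rewrite -scaleN1r opD opZ mulN1r.
have unit_ball a y : rnorm a < 1 -> pnorm (op a y) <= pnorm y.
  move=> a1; have [|||h [sh aa _]] := @sqrt_one_sub R A (cmul (star a) a) 0.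
  - by rewrite starM starK.
  - by rewrite rnorm_star_cmul expr_lt1// rnorm_ge0.
  - by rewrite cmul0l cmul0r.
  rewrite -(@ler_pXn2r _ 2)// ?nnegrE ?pnorm_ge0// !sqr_pnorm -subr_ge0.
  (* With 1 - a^* a = (1 - h)^2, this is |y|^2 - |a y|^2 = |y - h y|^2. *)
  have := Re_form_ge0 (psub y (op h y)).
  have -> : form (psub y (op h y)) (psub y (op h y)) = form y y - form (op a y) (op a y).
    rewrite form_subl !form_subr.
    have -> : form (op a y) (op a y) = form (op (cmul (star a) a) y) y.
      by rewrite op_mul (op_star (star a)) starK.
    rewrite aa opB opD op_mul (op_star h (op h y)) sh.
    have -> : form y (op h y) = form (op h y) y by rewrite op_star sh.
    by ring.
  by rewrite raddfB.
have scale t : rnorm c < t -> pnorm (op c x) <= t * pnorm x.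
  move=> ct; have t0 : 0 < t by rewrite (le_lt_trans (rnorm_ge0 c)).
  have kt : rnorm (t^-1%:C : R[i]) = t^-1 by rewrite rnormR ger0_norm ?invr_ge0 ?ltW.
  have := @unit_ball (t^-1%:C *: c) x; rewrite rnormZ kt mulrC ltr_pdivrMr// mul1r.
  move=> /(_ ct); rewrite -(ler_pM2l t0); apply: le_trans.
  suff -> : pnorm (op (t^-1%:C *: c) x) = t^-1 * pnorm (op c x).
    by rewrite mulrA mulfV ?gt_eqF// mul1r.
  rewrite -[X in X * _]kt -pnormZ /pnorm opZ formZl; congr (Num.sqrt (complex.Re (_ * _))).
  by rewrite formC opZ -formZl -formC.
apply/ler_addgt0Pl => e e0.
have p1 : 0 < pnorm x + 1 by rewrite ltr_wpDl ?pnorm_ge0.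
rewrite (le_trans (@scale (rnorm c + e / (pnorm x + 1)) _))//.
  by rewrite ltrDl divr_gt0.
rewrite mulrDl addrC lerD2r mulrAC ler_pdivrMr// ler_wpM2l ?(ltW e0)//.
by rewrite lerDl.
Qed.

End StarRep.

Lemma rep_contractive (R : realType) (G : lcGroupType) (A : gcstarType R G)
    (H : hilbertType R) (rho : A -> H -> H) (u : G -> H -> H) a x :
  covariant_rep rho u -> rnorm (rho a x) <= rnorm a * rnorm x.
Proof.
move=> cr; have := @star_rep_contractive R A (hilbert_form H) rho.
move=> /(_ _ _ _ _ a x); rewrite !pnorm_hilbert; apply.
- by move=> b y z; rewrite /= -{1}[b]starK (rho_star cr).
- by move=> b c y z; rewrite (rho_mul cr).
- by move=> b c y z; rewrite (linear_funD (rho_linear cr y)); exact: innerDl.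
- by move=> k b y z; rewrite (linear_funZ (rho_linear cr y)); exact: innerZl.
Qed.

(** * Integrated forms *)

Section Integral.
Context {R : realType} {G : lcGroupType} (mu : {measure set (borel G) -> \bar R}).
Context (haar : is_haar mu).
Context (K : set G) (cK : compact K).

Lemma compact_borel : measurable (K : set (borel G)).
Proof.
rewrite -[K]setCK; apply: measurableC; apply: sub_sigma_algebra.
rewrite openC; apply: compact_closed => //; exact: lcgroup_hausdorff.
Qed.

Lemma continuous_borel (g : G -> R) : continuous g ->
  measurable_fun [set: borel G] (g : borel G -> R).
Proof.
move=> cg; apply: (measurability _ (measurable_realfun.RGenOInfty.measurableE R)) => //.
move=> _ [_ [x ->] <-]; rewrite setTI; apply: sub_sigma_algebra.
by apply: open_comp => // s _; exact: cg.
Qed.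

Definition supported_in (V : zmodType) (f : G -> V) := forall s, ~ K s -> f s = 0.

Lemma continuous_integrable (g : G -> R) (M : R) : continuous g -> supported_in g ->
  (forall s, `|g s| <= M) -> mu.-integrable [set: borel G] (EFin \o (g : borel G -> R)).
Proof.
move=> cg gK gM.
have -> : EFin \o (g : borel G -> R) = (EFin \o (g : borel G -> R)) \_ (K : set (borel G)).
  apply/funext => s; rewrite patchE; case: ifPn => // /negP sK /=.
  by rewrite gK// => Ks; apply: sK; rewrite inE.
apply/(integrable_mkcond _ compact_borel).
apply: measurable_bounded_integrable.
- exact: compact_borel.
- exact: haar_compact.
- by apply: measurable_funS (continuous_borel cg) => //.
- exists M; split; first exact: num_real.
  by move=> x Mx s _ /=; rewrite (le_trans (gM s))// ltW.
Qed.

Lemma real_integral_bound (g : G -> R) (M : R) : continuous g -> supported_in g ->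
  (forall s, `|g s| <= M) ->
  `|\int[mu]_(s in [set: borel G]) (g : borel G -> R) s| <= M * fine (mu K).
Proof.
move=> cg gK gM; have ig := continuous_integrable cg gK gM.
have mK := compact_borel.
have igK : mu.-integrable (K : set (borel G)) (EFin \o (g : borel G -> R)).
  by apply: integrableS ig.
have -> : \int[mu]_(s in [set: borel G]) (g : borel G -> R) s =
          \int[mu]_(s in (K : set (borel G))) (g : borel G -> R) s.
  rewrite [RHS]Rintegral_mkcond; congr (Rintegral _ _ _); apply/funext => s.
  rewrite patchE; case: ifPn => // /negP sK /=.
  by rewrite gK// => Ks; apply: sK; rewrite inE.
apply: le_trans (le_normr_Rintegral mK igK) _.
rewrite -Rintegral_cst//; apply: le_Rintegral => //.
  by apply: integrable_norm igK.
apply: measurable_bounded_integrable => //; first exact: haar_compact.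
exists `|M|; split; first exact: num_real.
by move=> x Mx s _; rewrite ltW.
Qed.

Definition ccontinuous (f : G -> R[i]) := 
  forall t (e : R), 0 < e -> \forall s \near t, rnorm (f s - f t) <= e.

Definition integrand (f : G -> R[i]) (M : R) :=
  [/\ ccontinuous f, supported_in f & forall s, rnorm (f s) <= M].

Lemma ccontinuous_Re f : ccontinuous f -> continuous (fun s => complex.Re (f s)).
Proof.
move=> cf t; apply/cvgrPdist_le => e e0; apply: filterS (cf t e e0) => s fe.
by rewrite -raddfB (le_trans (normr_Re_le _))// rdistC.
Qed.

Lemma ccontinuous_Im f : ccontinuous f -> continuous (fun s => complex.Im (f s)).
Proof.
move=> cf t; apply/cvgrPdist_le => e e0; apply: filterS (cf t e e0) => s fe.
by rewrite -raddfB (le_trans (normr_Im_le _))// rdistC.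
Qed.

Section Integrand.
Context (f : G -> R[i]) (M : R) (fM : integrand f M).

Lemma integrand_Re : mu.-integrable [set: borel G]
  (EFin \o (fun s : borel G => complex.Re (f s))).
Proof.
case: fM => cf fK bf; apply: (@continuous_integrable _ M); first exact: ccontinuous_Re.
  by move=> s Ks; rewrite fK.
by move=> s; rewrite (le_trans (normr_Re_le _)).
Qed.

Lemma integrand_Im : mu.-integrable [set: borel G]
  (EFin \o (fun s : borel G => complex.Im (f s))).
Proof.
case: fM => cf fK bf; apply: (@continuous_integrable _ M); first exact: ccontinuous_Im.
  by move=> s Ks; rewrite fK.
by move=> s; rewrite (le_trans (normr_Im_le _)).
Qed.

Lemma cintegral_bound : rnorm (cintegral mu f) <= 2 * M * fine (mu K).
Proof.
case: fM => cf fK bf; rewrite (le_trans (rnorm_le_ReIm _))//= -mulrA mulr_natl mulr2n.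
apply: lerD.
  apply: real_integral_bound; first exact: ccontinuous_Re.
    by move=> s Ks; rewrite fK.
  by move=> s; rewrite (le_trans (normr_Re_le _)).
apply: real_integral_bound; first exact: ccontinuous_Im.
  by move=> s Ks; rewrite fK.
by move=> s; rewrite (le_trans (normr_Im_le _)).
Qed.

Lemma cintegralZ k : cintegral mu (fun s => k * f s) = k * cintegral mu f.
Proof.
have iRe := integrand_Re; have iIm := integrand_Im.
have iReZ a : mu.-integrable [set: borel G] (EFin \o (fun s : borel G => a * complex.Re (f s))).
  have h := integrableZl measurableT a iRe.
  by apply: eq_integrable h => // s _ /=; rewrite EFinM.
have iImZ a : mu.-integrable [set: borel G] (EFin \o (fun s : borel G => a * complex.Im (f s))).
  have h := integrableZl measurableT a iIm.
  by apply: eq_integrable h => // s _ /=; rewrite EFinM.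
case: k => a b; rewrite /cintegral; apply/eqP; rewrite eq_complex/=; apply/andP; split; apply/eqP.
  rewrite -!RintegralZl// -RintegralB//; apply: eq_Rintegral => s _.
  by case: (f s).
rewrite -!RintegralZl// -RintegralD//; apply: eq_Rintegral => s _.
by case: (f s).
Qed.

End Integrand.

Lemma cintegralD f g M N : integrand f M -> integrand g N ->
  cintegral mu (fun s => f s + g s) = cintegral mu f + cintegral mu g.
Proof.
move=> fM gN; rewrite /cintegral; apply/eqP; rewrite eq_complex/=.
apply/andP; split; apply/eqP.
  rewrite -RintegralD//; [|exact: integrand_Re fM|exact: integrand_Re gN].
  by apply: eq_Rintegral => s _; case: (f s); case: (g s).
rewrite -RintegralD//; [|exact: integrand_Im fM|exact: integrand_Im gN].
by apply: eq_Rintegral => s _; case: (f s); case: (g s).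
Qed.

End Integral.

Lemma linear_bounded_operator (R : realType) (H : hilbertType R) (T : H -> H) (C : R) :
  linear T -> (forall x, rnorm (T x) <= C * rnorm x) -> bounded_operator T.
Proof.
move=> lT TC; split=> //; apply/continuousP => t e e0.
have C1 : 0 < `|C| + 1 by rewrite ltr_wpDl.
have idc : continuous (@id H) by move=> x.
have /continuousP/(_ t (e / (`|C| + 1))) := idc.
have e0' : 0 < e / (`|C| + 1) by rewrite divr_gt0.
move=> /(_ e0'); apply: filterS => s /=.
rewrite ler_pdivlMr// => st.
have -> : T s - T t = T (s - t).
  by rewrite (linear_funB lT).
rewrite (le_trans (TC _))// (le_trans _ st)// mulrC ler_wpM2l ?rnorm_ge0//.
by rewrite ler_wpDr// ler_norm.
Qed.

Lemma bilinear_continuous (R : realType) (T : topologicalType) (U V : normedModType R[i])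
    (op : U -> V -> V) (f : T -> U) (v : T -> V) t (e : R) :
  (forall x, linear (fun a => op a x)) -> (forall a, linear (op a)) ->
  (forall a x, rnorm (op a x) <= rnorm a * rnorm x) ->
  (forall d : R, 0 < d -> \forall s \near t, rnorm (f s - f t) <= d) ->
  (forall d : R, 0 < d -> \forall s \near t, rnorm (v s - v t) <= d) ->
  0 < e -> \forall s \near t, rnorm (op (f s) (v s) - op (f t) (v t)) <= e.
Proof.
move=> opl opr ople cf cv e0; pose K := rnorm (v t) + 1 + rnorm (f t).
have K0 : 0 < K by rewrite ltr_wpDr ?rnorm_ge0// ltr_wpDl ?rnorm_ge0.
have eK0 : 0 < e / K by rewrite divr_gt0.
near=> s.
have fs : rnorm (f s - f t) <= e / K by near: s; exact: cf.
have vs : rnorm (v s - v t) <= e / K by near: s; exact: cv.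
have vs1 : rnorm (v s - v t) <= 1 by near: s; exact: cv.
have -> : op (f s) (v s) - op (f t) (v t) = op (f s - f t) (v s) + op (f t) (v s - v t).
  by rewrite (linear_funB (opl _)) (linear_funB (opr _)) addrA subrK.
have vs2 : rnorm (v s) <= rnorm (v t) + 1.
  by rewrite -(subrK (v t) (v s)) (le_trans (rnormD _ _))// addrC lerD2l.
rewrite (le_trans (rnormD _ _))// -[e](divfK (lt0r_neq0 K0)) {2}/K mulrDr lerD//.
  by rewrite (le_trans (ople _ _))// ler_pM ?rnorm_ge0.
by rewrite (le_trans (ople _ _))// mulrC ler_wpM2r ?rnorm_ge0.
Unshelve. all: by end_near. Qed.

Section IntegratedForm.
Context {R : realType} {G : lcGroupType} (mu : {measure set (borel G) -> \bar R}).
Context (haar : is_haar mu).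
Context {A : gcstarType R G} {H : hilbertType R} (rho : A -> H -> H) (u : G -> H -> H).
Context (cr : covariant_rep rho u).

Lemma rnorm_unitary s x : rnorm (u s x) = rnorm x.
Proof.
apply/eqP; rewrite -(@eqrXn2 _ 2)// ?rnorm_ge0// !sqr_rnorm.
by rewrite (u_unitary cr).
Qed.

Lemma covariant_linear a : linear (rho a).
Proof. by case: (rho_bounded cr a). Qed.

(** The weak integral is a bounded sesquilinear form, because the integrand is
    continuous, bounded by a multiple of |x| |y|, and vanishes off a compact
    set, which has finite Haar measure. The Riesz theorem turns the form into
    an operator. *)
Lemma integrated_form_exists (f : G -> A) : Cc A f ->
  exists T, integrated_form mu rho u f T.
Proof.
move=> [/continuousP cf cK]; set K := closure _ in cK.
have fK s : ~ K s -> f s = 0.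
  by move=> Ks; apply/eqP/negPn/negP => fs; apply: Ks; apply: subset_closure.
have [M fM] : exists M, forall s, rnorm (f s) <= M.
  have cn : continuous (fun s => rnorm (f s)).
    move=> t; apply/cvgrPdist_le => e e0; apply: filterS (cf t e e0) => s st.
    rewrite ler_norml; apply/andP; split.
      by have := rdistD (f t) (f s) 0; rewrite !subr0; lra.
    by have := rdistD (f s) (f t) 0; rewrite !subr0 rdistC; lra.
  have /compact_bounded[M [_ Mb]] : compact ((fun s => rnorm (f s)) @` K).
    by apply: continuous_compact cK; exact: continuous_subspaceT.
  exists (Num.max 0 (M + 1)) => s.
  have [Ks|/fK ->] := pselect (K s); last by rewrite rnorm0 le_max lexx.
  have := Mb (M + 1) _ (rnorm (f s)); rewrite ltrDl ltr01 => /(_ isT) /=.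
  rewrite ger0_norm ?rnorm_ge0// => fM; rewrite le_max fM ?orbT//.
  by exists s.
pose phi x y s := inner (rho (f s) (u s x)) y.
have bound x s : rnorm (rho (f s) (u s x)) <= M * rnorm x.
  rewrite (le_trans (rep_contractive _ _ cr))// rnorm_unitary.
  by rewrite ler_wpM2r ?rnorm_ge0.
have phiP x y : integrand K (phi x y) (M * rnorm x * rnorm y).
  split=> [t e e0|s /fK fs|s].
  - pose d := e / (rnorm y + 1).
    have y1 : 0 < rnorm y + 1 by rewrite ltr_wpDl ?rnorm_ge0.
    have d0 : 0 < d by rewrite divr_gt0.
    have /continuousP cu := @u_continuous _ _ _ _ _ _ cr x.
    have := bilinear_continuous (rho_linear cr) covariant_linear _ (cf t) (cu t) d0.
    move=> /(_ (fun a z => rep_contractive a z cr)); apply: filterS => s sd.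
    rewrite /phi -innerBl (le_trans (rnorm_inner _ _))//.
    rewrite (le_trans (ler_wpM2r (rnorm_ge0 _) sd))// /d mulrAC ler_pdivrMr//.
    by rewrite ler_wpM2l ?(ltW e0)// lerDl.
  - by rewrite /phi fs (linear_fun0 (rho_linear cr _)) inner0l.
  - by rewrite (le_trans (rnorm_inner _ _))// ler_wpM2r ?rnorm_ge0.
have phiB x y : rnorm (cintegral mu (phi x y)) <= (2 * M * fine (mu K) * rnorm x) * rnorm y.
  apply: le_trans (cintegral_bound haar cK (phiP x y)) _.
  by rewrite le_eqVlt; apply/orP; left; apply/eqP; ring.
have /choice[T TP] x : exists z, forall y, cintegral mu (phi x y) = inner z y.
  apply: riesz_representation (phiB x) => [y z|k y].
    rewrite -(cintegralD haar cK (phiP x y) (phiP x z)); congr cintegral.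
    by apply/funext => s; rewrite /phi innerDr.
  rewrite -(cintegralZ haar cK (phiP x y)); congr cintegral.
  by apply/funext => s; rewrite /phi innerZr.
exists T; split=> [|x y]; last by rewrite -TP.
apply: (@linear_bounded_operator _ _ _ (2 * M * fine (mu K))) => [k x y|x].
  apply: inner_eq => z; rewrite innerDl innerZl -!TP.
  rewrite -(cintegralZ haar cK (phiP x z)).
  have phiZ : (fun s => k * phi x z s) = phi (k *: x) z.
    apply/funext => s; rewrite /phi (linear_funZ (u_linear cr s)).
    by rewrite (linear_funZ (covariant_linear _)) innerZl.
  rewrite phiZ -(cintegralD haar cK (phiP _ z) (phiP _ z)); congr cintegral.
  apply/funext => s; rewrite /phi (linear_funD (u_linear cr s)).
  by rewrite (linear_funD (covariant_linear _)) innerDl.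
apply: rnorm_le_inner => [|y]; last by rewrite -TP.
rewrite !mulr_ge0 ?rnorm_ge0 ?fine_ge0//.
exact: le_trans (rnorm_ge0 _) (fM 1%g).
Qed.

End IntegratedForm.

(** * Covariant dilation *)

(** The semi-inner product << c (x) x | d (x) y >> = < psi (d^* c) x | y >,
    extended to formal sums of elementary tensors. *)
Definition gram (R : realType) (C : cstarType R) (H : hilbertType R)
    (psi : C -> H -> H) (z w : seq (C * H)) : R[i] :=
  \sum_(p <- z) \sum_(q <- w) inner (psi (cmul (star q.1) p.1) p.2) q.2.

Record covariant_ccp (R : realType) (G : lcGroupType) (C : gcstarType R G)
    (H : hilbertType R) (psi : C -> H -> H) (u : G -> H -> H) : Prop := CovariantCcp {
  ccp_linearl : forall x, linear (fun c => psi c x) ;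
  ccp_linear : forall c, linear (psi c) ;
  ccp_gram : forall z, 0 <= gram psi z z ;
  ccp_le : forall c x, rnorm (psi c x) <= rnorm c * rnorm x ;
  ccp_u_one : forall x, u 1%g x = x ;
  ccp_u_mul : forall s t x, u (s * t)%g x = u s (u t x) ;
  ccp_u_linear : forall s, linear (u s) ;
  ccp_u_unitary : forall s x y, inner (u s x) (u s y) = inner x y ;
  ccp_u_continuous : forall x, continuous (fun s => u s x) ;
  ccp_covariant : forall s c x, u s (psi c x) = psi (gact s c) (u s x)
}.

(** Positivity of the Gram form is complete positivity of g for the matrix
    (c_i^* c_j), which is X^* X for the matrix X with first row (c_j) and zeros
    elsewhere. *)
Lemma covariant_ccp_comp (R : realType) (G : lcGroupType) (C B : gcstarType R G)
    (H : hilbertType R) (g : C -> B) (rho : B -> H -> H) (u : G -> H -> H) :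
  equivariant_ccp g -> covariant_rep rho u -> covariant_ccp (fun c => rho (g c)) u.
Proof.
move=> [[gl gcp] gle geq] cr; split.
- by move=> x k a b; rewrite gl (rho_linear cr).
- by move=> c; exact: covariant_linear cr _.
- move=> z; pose n := size z; pose t := in_tuple z.
  pose M : 'M[C]_n := \matrix_(i, j) cmul (star (tnth t i).1) (tnth t j).1.
  have Mpos : mx_positive M.
    exists (\matrix_(k, i) if (k : nat) == 0%N then (tnth t i).1 else 0) => i j.
    have n0 : (0 < n)%N by case: (n) i => [[]|].
    rewrite (bigD1 (Ordinal n0))//= !mxE eqxx big1 ?addr0// => k k0.
    have /negbTE kn : (k : nat) != 0%N by apply: contraNneq k0 => k0; apply/eqP/val_inj.
    by rewrite !mxE kn cmul0r.
  have [Y gMY] := gcp n M Mpos.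
  pose w k := \sum_j rho (Y k j) (tnth t j).2.
  have -> : gram (fun c => rho (g c)) z z = \sum_k inner (w k) (w k).
    rewrite /gram big_tnth.
    under eq_bigr do rewrite big_tnth.
    under [RHS]eq_bigr do rewrite inner_suml.
    rewrite [RHS]exchange_big/=; apply: eq_bigr => j _.
    under [RHS]eq_bigr do rewrite inner_sumr.
    rewrite [RHS]exchange_big/=; apply: eq_bigr => i _.
    have := gMY i j; rewrite !mxE => ->.
    rewrite (linear_fun_sum (rho_linear cr _)) inner_suml; apply: eq_bigr => k _.
    by rewrite (rho_mul cr) (rho_star cr).
  by apply: sumr_ge0 => k _; exact: inner_ge0.
- move=> c x; rewrite (le_trans (rep_contractive _ _ cr))//.
  by rewrite ler_wpM2r ?rnorm_ge0// -rnorm_le.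
- exact: u_one cr.
- exact: u_mul cr.
- exact: u_linear cr.
- exact: u_unitary cr.
- by move=> x; exact: u_continuous cr _.
- by move=> s c x; rewrite (rho_covariant cr) geq.
Qed.

Section Dilation.
Context {R : realType} {G : lcGroupType} {C : gcstarType R G} {H : hilbertType R}.
Context (psi : C -> H -> H) (u : G -> H -> H).
Context (ccp : covariant_ccp psi u).
Implicit Types (z w : seq (C * H)) (c d e : C) (x y : H) (s t : G) (k : R[i]).

Let psil := ccp_linearl ccp.
Let psir := ccp_linear ccp.
Let ul := ccp_u_linear ccp.

Definition scale_seq k z : seq (C * H) := [seq (p.1, k *: p.2) | p <- z].

Lemma gramDl z z' w : gram psi (z ++ z') w = gram psi z w + gram psi z' w.
Proof. by rewrite /gram big_cat. Qed.

Lemma gramZl k z w : gram psi (scale_seq k z) w = k * gram psi z w.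
Proof.
rewrite /gram big_map mulr_sumr; apply: eq_bigr => p _.
rewrite mulr_sumr; apply: eq_bigr => q _ /=.
by rewrite (linear_funZ (psir _)) innerZl.
Qed.

Lemma gram1 c x d y : gram psi [:: (c, x)] [:: (d, y)] = inner (psi (cmul (star d) c) x) y.
Proof. by rewrite /gram !big_seq1. Qed.

(** A sesquilinear form with real diagonal is hermitian, by polarization. *)
Lemma gramC1 c x d y : inner (psi (cmul (star c) d) y) x =
  (inner (psi (cmul (star d) c) x) y)^*%C.
Proof.
have im0 z : complex.Im (gram psi z z) = 0 by apply: ger0_Im; exact: (ccp_gram ccp).
have := im0 [:: (c, x); (d, y)]; have := im0 [:: (c, x); (d, 'i *: y)].
have := im0 [:: (c, x)]; have := im0 [:: (d, y)]; have := im0 [:: (d, 'i *: y)].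
rewrite /gram !big_cons !big_nil !addr0/= !(linear_funZ (psir _)) !innerZl !innerZr.
have -> : ('i : R[i])^*%C = - 'i by apply/eqP; rewrite eq_complex/= oppr0 !eqxx.
case: (inner (psi (cmul (star c) c) x) x) => a1 a2.
case: (inner (psi (cmul (star d) d) y) y) => b1 b2.
case: (inner (psi (cmul (star d) c) x) y) => c1 c2.
case: (inner (psi (cmul (star c) d) y) x) => d1 d2 /=.
move=> *; apply/eqP; rewrite eq_complex/=; apply/andP; split; apply/eqP; lra.
Qed.

Lemma gramC z w : gram psi w z = (gram psi z w)^*%C.
Proof.
have conj_sum (I : Type) (r : seq I) (F : I -> R[i]) :
    (\sum_(i <- r) F i)^*%C = \sum_(i <- r) (F i)^*%C.
  by elim/big_ind2 : _ => [|a b a' b' <- <-|//]; rewrite ?conjc0 ?conjcD.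
rewrite /gram conj_sum exchange_big/=; apply: eq_bigr => p _.
rewrite conj_sum; apply: eq_bigr => q _; exact: gramC1.
Qed.

Definition dilation_space : prehilbert R :=
  @PreHilbert R (seq (C * H)) [::] cat scale_seq (gram psi) gramDl gramZl gramC (ccp_gram ccp).
Local Notation P := dilation_space.

Lemma pnorm1_le c x : pnorm ([:: (c, x)] : P) <= rnorm c * rnorm x.
Proof.
rewrite -(@ler_pXn2r _ 2)// ?nnegrE ?pnorm_ge0 ?mulr_ge0 ?rnorm_ge0//.
rewrite sqr_pnorm/= gram1 (le_trans (Re_le_rnorm _))// (le_trans (rnorm_inner _ _))//.
rewrite exprMn [rnorm x ^+ 2]expr2 mulrA ler_wpM2r ?rnorm_ge0//.
by rewrite (le_trans (ccp_le ccp _ _))// rnorm_star_cmul.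
Qed.

Lemma psi_approx c x (e : R) : 0 < e -> exists2 a, rnorm a <= 1 &
  rnorm (psi (c - cmul a c) x) <= e.
Proof.
move=> e0; have x1 : 0 < rnorm x + 1 by rewrite ltr_wpDl ?rnorm_ge0.
have [|a a1 ac] := @approx_unit1 R C c (e / (rnorm x + 1)); first by rewrite divr_gt0.
exists a => //; rewrite (le_trans (ccp_le ccp _ _))//.
rewrite (le_trans (ler_wpM2r (rnorm_ge0 _) ac))// mulrAC ler_pdivrMr//.
by rewrite ler_wpM2l ?(ltW e0)// lerDl.
Qed.

(** For a product a c it is the hermitian symmetry of the Gram form; products are
    dense by means of approximate units. *)
Lemma psi_star c x y : inner (psi c x) y = inner x (psi (star c) y).
Proof.
apply/eqP; rewrite -subr_eq0; apply/eqP.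
apply: (@rnorm_le0_scale _ _ _ (rnorm x * rnorm y + rnorm x * rnorm y)) => d d0 _.
have [a a1 ac] := approx_unit1 c d0.
have ac_eq : inner (psi (cmul a c) x) y = inner x (psi (star (cmul a c)) y).
  by rewrite [RHS]inner_conj starM gramC1 starK conjcK.
have -> : inner (psi c x) y - inner x (psi (star c) y) =
    inner (psi (c - cmul a c) x) y - inner x (psi (star (c - cmul a c)) y).
  rewrite starB (linear_funB (psil x)) (linear_funB (psil y)) innerBl innerBr.
  by rewrite ac_eq opprB addrA subrK.
rewrite (le_trans (rnormB _ _))// mulrDl lerD//.
  rewrite (le_trans (rnorm_inner _ _))// mulrAC ler_wpM2r ?rnorm_ge0//.
  by rewrite (le_trans (ccp_le ccp _ _))// mulrC ler_wpM2l ?rnorm_ge0.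
rewrite (le_trans (rnorm_inner _ _))// -mulrA ler_wpM2l ?rnorm_ge0//.
by rewrite (le_trans (ccp_le ccp _ _))// rnorm_star mulrC ler_wpM2l ?rnorm_ge0.
Qed.

Definition compress z : H := \sum_(p <- z) psi p.1 p.2.
Definition lmul c z : seq (C * H) := [seq (cmul c p.1, p.2) | p <- z].
Definition translate s z : seq (C * H) := [seq (gact s p.1, u s p.2) | p <- z].

(** The vector on the left is paired with y by < z | e^* (x) y >, and
    |e^* (x) y| <= |y| by contractivity of psi. *)
Lemma compress_lmul_le e z : rnorm e <= 1 -> rnorm (compress (lmul e z)) <= pnorm (z : P).
Proof.
move=> e1; apply: rnorm_le_inner => [|y]; first exact: pnorm_ge0.
have -> : inner (compress (lmul e z)) y = form (z : P) [:: (star e, y)].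
  rewrite /compress big_map inner_suml/= /gram; apply: eq_bigr => p _.
  by rewrite big_seq1 starK.
rewrite (le_trans (cauchy_schwarz _ _))// ler_wpM2l ?pnorm_ge0//.
rewrite (le_trans (pnorm1_le _ _))// rnorm_star.
by rewrite -[leRHS]mul1r ler_wpM2r ?rnorm_ge0.
Qed.

Lemma psi_le_gram d x : rnorm (psi d x) <= pnorm ([:: (d, x)] : P).
Proof.
apply/ler_addgt0Pl => e /(psi_approx d x)[a a1 ad].
have -> : psi d x = psi (d - cmul a d) x + compress (lmul a [:: (d, x)]).
  by rewrite /compress big_seq1/= (linear_funB (psil x)) subrK.
by rewrite (le_trans (rnormD _ _))// lerD// compress_lmul_le.
Qed.

Lemma inner_psi_le d x y : rnorm (inner (psi d x) y) <=
  rnorm x * Num.sqrt (complex.Re (inner (psi (cmul d (star d)) y) y)).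
Proof.
rewrite psi_star (le_trans (rnorm_inner _ _))// ler_wpM2l ?rnorm_ge0//.
rewrite (le_trans (psi_le_gram _ _))// /pnorm/= gram1 starK//.
Qed.

Lemma sum_mul_sqrt_le (I : Type) (r : seq I) (a q : I -> R) :
  (forall i, 0 <= a i) -> (forall i, 0 <= q i) ->
  \sum_(i <- r) a i * Num.sqrt (q i) <=
  (\sum_(i <- r) a i) * Num.sqrt (\sum_(i <- r) q i).
Proof.
move=> a0 q0; elim: r => [|i r IH]; first by rewrite !big_nil mul0r.
rewrite !big_cons mulrDl lerD//.
  by rewrite ler_wpM2l// ler_wsqrtr// lerDl sumr_ge0.
by rewrite (le_trans IH)// ler_wpM2l ?sumr_ge0// ler_wsqrtr// lerDr.
Qed.

(** Write d' for the adjoint of d. As psi d is the adjoint of psi d', the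
    Schwarz inequality for the single element d' bounds < psi d x | y > by
    |x| < psi (d d') y | y >^(1/2). Adding these bounds up needs no comparison
    of |d d'| with the norm of a sum in C: only the numbers
    < psi (d d') y | y > >= 0 are compared with their sum. *)
Lemma compress_le_defect z : rnorm (compress z) <= (\sum_(p <- z) rnorm p.2) *
  Num.sqrt (rnorm (\sum_(p <- z) cmul p.1 (star p.1))).
Proof.
set S := \sum_(p <- z) cmul _ _.
apply: rnorm_le_inner => [|y].
  by rewrite mulr_ge0 ?sqrtr_ge0// sumr_ge0// => p _; exact: rnorm_ge0.
rewrite /compress inner_suml (le_trans (rnorm_sum _ _))//.
pose q (p : C * H) := complex.Re (inner (psi (cmul p.1 (star p.1)) y) y).
have q0 p : 0 <= q p.
  have := ccp_gram ccp [:: (star p.1, y)]; rewrite gram1 starK.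
  by rewrite lecE => /andP[].
have le1 : \sum_(p <- z) rnorm (inner (psi p.1 p.2) y) <=
    \sum_(p <- z) rnorm p.2 * Num.sqrt (q p).
  by apply: ler_sum => p _; exact: inner_psi_le.
apply: (le_trans le1); apply: (le_trans (sum_mul_sqrt_le _ _ q0)) => [p|].
  exact: rnorm_ge0.
rewrite -mulrA ler_wpM2l//; first by apply: sumr_ge0 => p _; exact: rnorm_ge0.
have -> : \sum_(p <- z) q p = complex.Re (inner (psi S y) y).
  by rewrite /S (linear_fun_sum (psil y)) inner_suml raddf_sum.
rewrite -[rnorm y]ger0_norm ?rnorm_ge0// -sqrtr_sqr -sqrtrM ?rnorm_ge0//.
rewrite ler_wsqrtr// (le_trans (Re_le_rnorm _))// (le_trans (rnorm_inner _ _))//.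
by rewrite expr2 mulrA ler_wpM2r ?rnorm_ge0// (ccp_le ccp).
Qed.

(** The Schwarz inequality for psi, in the absence of a unit. An approximate
    unit e for the entries of z splits z into e z, which is controlled
    by contractivity of psi, and z - e z, which is small by
    [compress_le_defect]. *)
Lemma compress_le z : rnorm (compress z) <= pnorm (z : P).
Proof.
pose X := \sum_(p <- z) rnorm p.2.
have X0 : 0 <= X by apply: sumr_ge0 => p _; exact: rnorm_ge0.
apply/ler_addgt0Pl => e e0; have X1 : 0 < X + 1 by rewrite ltr_wpDl.
have d0 : 0 < e / (X + 1) by rewrite divr_gt0.
have [|a a1 az] := @approx_unit R C [seq p.1 | p <- z] ((e / (X + 1)) ^+ 2).
  by rewrite exprn_gt0.
pose dz : seq (C * H) := [seq (p.1 - cmul a p.1, p.2) | p <- z].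
have -> : compress z = compress dz + compress (lmul a z).
  rewrite /compress !big_map -big_split; apply: eq_bigr => p _ /=.
  by rewrite (linear_funB (psil _)) subrK.
rewrite (le_trans (rnormD _ _))// lerD ?compress_lmul_le//.
rewrite (le_trans (compress_le_defect _))// !big_map -/X.
rewrite big_map in az.
have sle : Num.sqrt (rnorm (\sum_(p <- z) cmul (p.1 - cmul a p.1)
    (star (p.1 - cmul a p.1)))) <= e / (X + 1).
  by rewrite -[leRHS]ger0_norm ?(ltW d0)// -sqrtr_sqr ler_wsqrtr.
rewrite (le_trans (ler_wpM2l X0 sle))// mulrCA ler_piMr ?(ltW e0)//.
by rewrite ler_pdivrMr// mul1r lerDl.
Qed.

Lemma form_lmul_star c z w : form (lmul c z : P) w = form (z : P) (lmul (star c) w).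
Proof.
rewrite /= /gram big_map; apply: eq_bigr => p _; rewrite big_map; apply: eq_bigr => q _ /=.
by rewrite starM starK cmulA.
Qed.

Lemma form_lmulD c d z w : form (lmul (c + d) z : P) w = form (lmul c z : P) w + form (lmul d z : P) w.
Proof.
rewrite /= /gram !big_map -big_split; apply: eq_bigr => p _ /=.
rewrite -big_split; apply: eq_bigr => q _ /=.
by rewrite cmulDl cmulDr (linear_funD (psil _)) innerDl.
Qed.

Lemma form_lmulZ k c z w : form (lmul (k *: c) z : P) w = k * form (lmul c z : P) w.
Proof.
rewrite /= /gram !big_map mulr_sumr; apply: eq_bigr => p _ /=.
rewrite mulr_sumr; apply: eq_bigr => q _ /=.
by rewrite cmulZl cmulZr (linear_funZ (psil _)) innerZl.
Qed.

Lemma lmulM c d z : lmul (cmul c d) z = lmul c (lmul d z).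
Proof. by rewrite /lmul -map_comp; apply: eq_map => p /=; rewrite cmulA. Qed.

Lemma lmul_le c z : pnorm (lmul c z : P) <= rnorm c * pnorm (z : P).
Proof.
apply: (@star_rep_contractive R C P lmul) => [a||a b v w'|k a v w'].
- exact: form_lmul_star.
- by move=> a b v w'; rewrite lmulM.
- exact: form_lmulD.
- exact: form_lmulZ.
Qed.

Lemma form_translate s z w : form (translate s z : P) (translate s w) = form (z : P) w.
Proof.
rewrite /= /gram big_map; apply: eq_bigr => p _; rewrite big_map; apply: eq_bigr => q _ /=.
by rewrite -gact_star -gact_mul -(ccp_covariant ccp) (ccp_u_unitary ccp).
Qed.

Lemma translateM s t z : translate (s * t)%g z = translate s (translate t z).
Proof.
rewrite /translate -map_comp; apply: eq_map => p /=.
by rewrite gactM (ccp_u_mul ccp).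
Qed.

Lemma translate1 z : translate 1%g z = z.
Proof. by rewrite /translate map_id_in// => -[c x] _; rewrite gact1 (ccp_u_one ccp). Qed.

Lemma form_translate_adj s z w :
  form (translate s z : P) w = form (z : P) (translate s^-1%g w).
Proof.
by rewrite -[in RHS](form_translate s) -translateM mulgV translate1.
Qed.

Lemma compress_translate s z : compress (translate s z) = u s (compress z).
Proof.
rewrite /compress big_map (linear_fun_sum (ul s)); apply: eq_bigr => p _ /=.
by rewrite (ccp_covariant ccp).
Qed.

Definition lmul_map c : bounded_map P P.
Proof.
apply: (@BoundedMap R P P (lmul c)) => [z w|k z|].
- exact: map_cat.
- by rewrite /= /lmul /scale_seq -!map_comp.
by exists (rnorm c); [exact: rnorm_ge0|exact: lmul_le].
Defined.

Definition translate_map s : bounded_map P P.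
Proof.
apply: (@BoundedMap R P P (translate s)) => [z w|k z|].
- exact: map_cat.
- rewrite /= /translate /scale_seq -!map_comp; apply: eq_map => p /=.
  by rewrite (linear_funZ (ul s)).
exists 1 => // z; rewrite mul1r /pnorm le_eqVlt; apply/orP; left; apply/eqP.
by rewrite form_translate.
Defined.

Definition compress_map : bounded_map P (hilbert_form H).
Proof.
apply: (@BoundedMap R P (hilbert_form H) compress) => [z w|k z|].
- exact: big_cat.
- rewrite /= /compress big_map scaler_sumr; apply: eq_bigr => p _ /=.
  by rewrite (linear_funZ (psir _)).
by exists 1 => // z; rewrite mul1r pnorm_hilbert compress_le.
Defined.

Local Notation D := (bounded_antilinear P).

Definition dil_rep c (F : D) : D := pullback (lmul_map (star c)) F.
Definition dil_unitary s (F : D) : D := pullback (translate_map s^-1%g) F.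
Definition dil_embed x : D := pullback compress_map (riesz (x : hilbert_form H)).

Lemma afun_ext (F : D) (z w : P) : (forall v : P, form z v = form w v) -> F z = F w.
Proof.
move=> zw; apply/eqP; rewrite -subr_eq0 -afun_sub; apply/eqP/rnorm0_eq0/eqP.
rewrite eq_le rnorm_ge0 andbT (le_trans (afun_rnorm_le _ _))//.
by rewrite /pnorm form_subl zw subrr sqrtr0 mulr0.
Qed.

(** Translations are isometric, so that this weak continuity implies the strong
    continuity of the representation of G on the dilation. *)
Lemma form_translate_continuous t z w (e : R) : 0 < e ->
  \forall s \near t, rnorm (form (translate s z : P) w - form (translate t z : P) w) <= e.
Proof.
have near_sum (I : Type) (r : seq I) (phi : I -> G -> R[i]) :
    (forall i (d : R), 0 < d -> \forall s \near t, rnorm (phi i s - phi i t) <= d) ->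
    forall d : R, 0 < d ->
    \forall s \near t, rnorm (\sum_(i <- r) phi i s - \sum_(i <- r) phi i t) <= d.
  move=> cphi; elim: r => [|i r IH] d d0.
    by apply: nearW => s; rewrite !big_nil subrr rnorm0 ltW.
  near=> s; rewrite !big_cons opprD addrACA (le_trans (rnormD _ _))//.
  rewrite [leRHS]splitr lerD//.
    by near: s; apply: cphi; rewrite divr_gt0.
  by near: s; apply: IH; rewrite divr_gt0.
have gramE s : gram psi (translate s z) w = \sum_(p <- z) \sum_(q <- w)
    inner (psi (cmul (star q.1) (gact s p.1)) (u s p.2)) q.2.
  by rewrite /gram big_map.
move=> e0; suff : \forall s \near t, rnorm (
    \sum_(p <- z) \sum_(q <- w) inner (psi (cmul (star q.1) (gact s p.1)) (u s p.2)) q.2 -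
    \sum_(p <- z) \sum_(q <- w) inner (psi (cmul (star q.1) (gact t p.1)) (u t p.2)) q.2) <= e.
  by apply: filterS => s; rewrite -!gramE.
apply: (near_sum _ z (fun p s => \sum_(q <- w)
  inner (psi (cmul (star q.1) (gact s p.1)) (u s p.2)) q.2)) e0 => p d d0.
apply: (near_sum _ w (fun q s => 
  inner (psi (cmul (star q.1) (gact s p.1)) (u s p.2)) q.2)) d0 => q {}d d0.
have y1 : 0 < rnorm q.2 + 1 by rewrite ltr_wpDl ?rnorm_ge0.
have d1 : 0 < d / (rnorm q.2 + 1) by rewrite divr_gt0.
have /continuousP/(_ t) cv : continuous (fun s => u s p.2).
  by move=> s; exact: (ccp_u_continuous ccp).
have cf (d' : R) : 0 < d' -> \forall s \near t,
    rnorm (cmul (star q.1) (gact s p.1) - cmul (star q.1) (gact t p.1)) <= d'.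
  move=> d'0; have q1 : 0 < rnorm q.1 + 1 by rewrite ltr_wpDl ?rnorm_ge0.
  have /continuousP/(_ t _ (divr_gt0 d'0 q1)) : continuous (fun s => gact s p.1).
    by move=> s; exact: gact_continuous.
  apply: filterS => s sd.
  rewrite -cmulBr (le_trans (rnorm_cmul _ _))// rnorm_star.
  rewrite (le_trans (ler_wpM2l (rnorm_ge0 _) sd))// mulrCA ler_piMr ?(ltW d'0)//.
  by rewrite ler_pdivrMr// mul1r lerDl.
have := bilinear_continuous psil psir (ccp_le ccp) cf cv d1.
apply: filterS => s sd; rewrite -innerBl (le_trans (rnorm_inner _ _))//.
rewrite (le_trans (ler_wpM2r (rnorm_ge0 _) sd))// mulrAC ler_pdivrMr//.
by rewrite ler_wpM2l ?(ltW d0)// lerDl.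
Unshelve. all: by end_near. Qed.

Lemma dil_unitary_riesz s z : dil_unitary s (riesz (z : P)) = riesz (translate s z : P).
Proof.
apply: (pullback_riesz (S := translate_map s)) => v w; exact: form_translate_adj.
Qed.

Lemma rnorm_dil_unitary s F : rnorm (dil_unitary s F) <= rnorm F.
Proof.
rewrite -[leRHS]mul1r; apply: pullback_le => // z; rewrite mul1r /pnorm.
by rewrite le_eqVlt form_translate eqxx.
Qed.

Lemma dil_unitary_continuous (F : D) : continuous (fun s => dil_unitary s F).
Proof.
apply/continuousP => t e e0.
have e3 : 0 < e / 3 by rewrite divr_gt0.
have [z zF] := riesz_approx F e3.
have ee : 0 < (e / 3) ^+ 2 / 2 by rewrite divr_gt0// exprn_gt0.
apply: filterS (form_translate_continuous t z (translate t z) ee) => s.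
rewrite (form_translate t) => sz.
have trz : rnorm (dil_unitary s (riesz (z : P)) - dil_unitary t (riesz (z : P))) <= e / 3.
  rewrite !dil_unitary_riesz -riesz_sub rnorm_riesz.
  rewrite -(@ler_pXn2r _ 2)// ?nnegrE ?pnorm_ge0 ?(ltW e3)// sqr_pnorm.
  rewrite form_subl !form_subr !form_translate.
  have -> : form (translate t z : P) (translate s z) =
      (form (translate s z : P) (translate t z))^*%C by rewrite -formC.
  move: sz; set a := form (translate s z : P) _; set b := form (z : P) z => sz.
  have -> : b - a - (a^*%C - b) = - (a - b) - (a - b)^*%C + (b - b^*%C).
    by rewrite conjcD conjcN; ring.
  have -> : b^*%C = b by rewrite /b -formC.
  rewrite subrr addr0 (le_trans (Re_le_rnorm _))// (le_trans (rnormB _ _))//.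
  by rewrite rnormN rnormJ; move: sz; lra.
have tri s' : rnorm (dil_unitary s' F - dil_unitary s' (riesz (z : P))) <= e / 3.
  by rewrite -pullbackB (le_trans (rnorm_dil_unitary s' _)).
have := rdistD (dil_unitary s (riesz (z : P))) (dil_unitary s F) (dil_unitary t F).
have := rdistD (dil_unitary t (riesz (z : P))) (dil_unitary s (riesz (z : P))) (dil_unitary t F).
have := tri s; have := tri t; rewrite (rdistC (dil_unitary t F)); lra.
Qed.

Lemma lmul_adj c (v w : P) : form (lmul_map c v) w = form v (lmul_map (star c) w).
Proof. exact: form_lmul_star. Qed.

Lemma translate_adj s (v w : P) :
  form (translate_map s v) w = form v (translate_map s^-1%g w).
Proof. exact: form_translate_adj. Qed.

Lemma dilation_covariant : covariant_rep dil_rep dil_unitary.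
Proof.
split.
- move=> c; apply: (@linear_bounded_operator _ _ _ (rnorm (star c))).
    exact: pullback_linear.
  by move=> F; apply: pullback_le; [exact: rnorm_ge0|exact: lmul_le].
- move=> F k c d; apply: afun_inj => z; rewrite add_afunE scale_afunE /=.
  pose w : P := ph_add (ph_scale k^*%C (lmul (star c) z : P)) (lmul (star d) z : P).
  have -> : k * F (lmul (star c) z) + F (lmul (star d) z) = F w.
    by rewrite afunD afunZ conjcK.
  apply: afun_ext => v; rewrite starD starZ form_lmulD form_lmulZ formDl formZl //.
- by move=> c d F; apply: afun_inj => z /=; rewrite starM lmulM.
- move=> c F F'; rewrite /dil_rep.
  by apply: inner_pullback => v w; rewrite lmul_adj !starK.
- by move=> F; apply: afun_inj => z /=; rewrite invg1 translate1.
- by move=> s t F; apply: afun_inj => z /=; rewrite invgM translateM.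
- by move=> s; exact: pullback_linear.
- move=> s F F'; rewrite /dil_unitary (inner_pullback (S := translate_map s)) => [|v w].
    congr inner; apply: afun_inj => z /=.
    by rewrite -translateM mulVg translate1.
  exact: translate_adj.
- exact: dil_unitary_continuous.
- move=> s c F; apply: afun_inj => z /=; congr (afun F _).
  rewrite /lmul /translate -!map_comp; apply: eq_map => p /=.
  by rewrite gact_mul -gact_star -gactM mulVg gact1.
Qed.

Lemma rnorm_dil_embed x : rnorm (dil_embed x) <= rnorm x.
Proof.
have := @rnorm_riesz R (hilbert_form H) x; rewrite pnorm_hilbert => <-.
rewrite -[leRHS]mul1r; apply: pullback_le => // z; rewrite mul1r pnorm_hilbert.
exact: compress_le.
Qed.

(** This is V^* rho'(c) u'_s V = psi c u_s. It follows from u'_s V = V u_s and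
    from rho'(c) V x = << c (x) x | - >>, which is where [psi_star] is used. *)
Lemma dilation_compression c s x y :
  inner (dil_rep c (dil_unitary s (dil_embed x))) (dil_embed y) = inner (psi c (u s x)) y.
Proof.
have -> : dil_unitary s (dil_embed x) = dil_embed (u s x).
  apply: afun_inj => z /=; rewrite compress_translate.
  rewrite -[RHS](ccp_u_unitary ccp s^-1%g) -(ccp_u_mul ccp) mulVg.
  by rewrite (ccp_u_one ccp).
have -> : dil_rep c (dil_embed (u s x)) = riesz ([:: (c, u s x)] : P).
  apply: afun_inj => z /=; rewrite /gram big_seq1 /compress big_map inner_sumr.
  by apply: eq_bigr => p _ /=; rewrite [RHS]psi_star starM starK.
rewrite inner_conj inner_riesz /= /compress big_seq1/= -inner_conj//.
Qed.

End Dilation.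

(** * Comparison of norms *)

Lemma opnorm_dilation (R : realType) (H K : hilbertType R) (T : H -> H) (S : K -> K)
    (V : H -> K) : (forall x, rnorm (V x) <= rnorm x) ->
  (forall x y, inner (T x) y = inner (S (V x)) (V y)) -> (opnorm T <= opnorm S)%E.
Proof.
move=> V1 TS; apply: ge_ereal_sup => _ [x x1 <-].
apply: (@le_trans _ _ (rnorm (S (V x)))%:E); last first.
  apply: ereal_sup_ubound; exists (V x) => //=.
  by rewrite (le_trans _ x1)// rnorm_le.
rewrite lee_fin; apply: rnorm_le_inner => [|y]; first exact: rnorm_ge0.
by rewrite TS (le_trans (rnorm_inner _ _))// ler_wpM2l ?rnorm_ge0.
Qed.

Lemma crossed_map_Cc (R : realType) (G : lcGroupType) (A B : gcstarType R G)
    (f : A -> B) (a : G -> A) : star_hom f -> injective f -> Cc A a -> Cc B (crossed_map f a).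
Proof.
move=> fh finj [/continuousP ca Ka]; have [lf _ _] := fh; split.
  apply/continuousP => t e e0; apply: filterS (ca t e e0) => s.
  rewrite /crossed_map /= -(linear_funB lf); apply: le_trans.
  exact: star_hom_contractive.
suff -> : [set s | crossed_map f a s != 0] = [set s | a s != 0] by [].
apply/seteqP; split=> s /=; apply: contra => /eqP as0; apply/eqP.
  by rewrite /crossed_map /= as0 (linear_fun0 lf).
by apply: finj; rewrite (linear_fun0 lf).
Qed.

(** The integrated form of g o f compresses the one of f under the dilation. *)
Lemma max_norm_ccp (R : realType) (G : lcGroupType)
    (mu : {measure set (borel G) -> \bar R}) (C B : gcstarType R G) (g : C -> B)
    (f : G -> C) : is_haar mu -> equivariant_ccp g -> Cc C f ->
  (max_norm mu (crossed_map g f) <= max_norm mu f)%E.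
Proof.
move=> haar gccp fC; apply: ge_ereal_sup => _ [H [rho [u [T [cr [_ TE] ->]]]]].
have ccp := covariant_ccp_comp gccp cr.
have [S SE] := integrated_form_exists haar (dilation_covariant ccp) fC.
apply: (@le_trans _ _ (opnorm S)); last first.
  apply: ereal_sup_ubound; exists (bounded_antilinear (dilation_space ccp)).
  by exists (@dil_rep _ _ _ _ _ _ ccp), (@dil_unitary _ _ _ _ _ _ ccp), S; split=> //; exact: dilation_covariant.
apply: (opnorm_dilation (V := dil_embed ccp)) => [x|x y]; first exact: rnorm_dil_embed.
have [_ ->] := SE; rewrite TE; congr cintegral; apply/funext => s.
by rewrite dilation_compression.
Qed.

Theorem lemma3p2 (R : realType) (G : lcGroupType)
  (mu : {measure set (borel G) -> \bar R}) (mu_haar : is_haar mu)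
  (A B : gcstarType R G) (pi : A -> B)
  (pi_emb : equivariant_embedding pi) (pi_inj : G_injective pi)
  (a : G -> A) (a_Cc : Cc A a) :
  inj_norm mu a = max_norm mu (crossed_map pi a).
Proof.
apply/eqP; rewrite eq_le; apply/andP; split.
  by apply: ereal_inf_lbound; exists B, pi.
apply: le_ereal_inf_tmp => _ [C [iota [iota_emb ->]]].
have [g gccp gi] := pi_inj.2 C iota iota_emb.
have [iota_hom iotaI _] := iota_emb.
have -> : crossed_map pi a = crossed_map g (crossed_map iota a) by rewrite -gi.
exact/max_norm_ccp/crossed_map_Cc.
Qed.
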